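(* Let $k\geq 1$ and let $u$ be the $\mathcal{P}(\mathbb{Z})/\mathcal{I}_{k\text{-}\mathsf{thin}}$-generic ultrafilter on $\mathbb{Z}$ over the ground model $V$. Then (in the generic extension $V[u]$) $u$ is a P-point that is not $\mathbb{Z}$-Ramsey.
   Context: A set $A\subseteq\mathbb{Z}$ is $k$-thin if $|(g+A)\cap A|\leq k$ for every $g\in\mathbb{Z}\setminus\{0\}$. $\mathcal{I}_{k\text{-}\mathsf{thin}}$ is the ideal on $\mathbb{Z}$ consisting of all $I\subseteq\mathbb{Z}$ that are contained in a union of finitely many $k$-thin sets. $\mathcal{P}(\mathbb{Z})/\mathcal{I}_{k\text{-}\mathsf{thin}}$ is the quotient Boolean algebra, whose nonzero elements are used as a forcing notion (equivalently, one forces with the $\mathcal{I}_{k\text{-}\mathsf{thin}}$-positive sets, i.e. the sets $X\subseteq\mathbb{Z}$ with $X\notin\mathcal{I}_{k\text{-}\mathsf{thin}}$, ordered by $\subseteq$); the generic ultrafilter $u$ is the family of all $A\subseteq\mathbb{Z}$ whose equivalence class belongs to the generic filter. A nonprincipal ultrafilter on a countable set $S$ is a P-point if every function $f:S\to\omega$ is constant or finite-to-one on some element of it. A colouring $c:[\mathbb{Z}]^2\to 2$ is $\mathbb{Z}$-invariant if $c(\{x,y\})=c(\{x+z,y+z\})$ for all distinct $x,y\in\mathbb{Z}$ and all $z\in\mathbb{Z}$. An ultrafilter $u$ on $\mathbb{Z}$ is $\mathbb{Z}$-Ramsey if for every $\mathbb{Z}$-invariant colouring $c:[\mathbb{Z}]^2\to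 2$ there is $A\in u$ such that $c$ is constant on $[A]^2$. *)

(* Defs.v *)
From mathcomp Require Import all_boot all_order all_algebra.
From mathcomp Require Import boolp classical_sets functions cardinality.
Set Implicit Arguments.
Unset Strict Implicit.
Unset Printing Implicit Defensive.
Import GRing.Theory.
Local Open Scope classical_set_scope.
Local Open Scope card_scope.
Local Open Scope ring_scope.

(** * Forcing

    The ground model V is the universe of types: a set of V is presented by a
    type indexing its elements, and a P-name by a family of pairs
    (name, condition).  A statement about V[G] is a formula of the forcing
    language, and "it holds in V[G] for every V-generic filter G" means that
    every condition forces it. *)

Record forcing_notion := ForcingNotion {
  cond :> Type;
  stronger : cond -> cond -> Prop;
  stronger_refl : forall p, stronger p p;
  stronger_trans : forall q p r, stronger p q -> stronger q r -> stronger p r }.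

Declare Scope forcing_scope.
Delimit Scope forcing_scope with F.
Local Open Scope forcing_scope.

Notation "p ≼ q" := (stronger p q) (at level 70, no associativity) : type_scope.

(* [Name s r] is the P-name {(s i, r i) | i : I}. *)
Inductive name (P : forcing_notion) : Type :=
  Name (I : Type) (s : I -> name P) (r : I -> P).

(* Formulas of set theory whose constants are the P-names. *)
Inductive formula (P : forcing_notion) : Type :=
| FMem (a b : name P)
| FEq (a b : name P)
| FNot (phi : formula P)
| FAnd (phi psi : formula P)
| FAll (phi : name P -> formula P).

Definition dense_below (P : forcing_notion) (D : P -> Prop) (p : P) : Prop :=
  forall q : P, q ≼ p -> exists2 r : P, r ≼ q & D r.

(* p forces a = b iff, whenever (c, r) is in one of the two names and q is
   stronger than p and r, q forces that c is in the other one.  Membership is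
   unfolded here ([forces_mem] below) to make the recursion structural. *)
Fixpoint forces_eq (P : forcing_notion) (a b : name P) (p : P) {struct a} :
    Prop :=
  match a, b with
  | Name X s r, Name Y t w =>
      (forall (i : X) (q : P), q ≼ p -> q ≼ r i ->
         dense_below
           (fun q' => exists2 j : Y, q' ≼ w j & forces_eq (s i) (t j) q') q) /\
      (forall (j : Y) (q : P), q ≼ p -> q ≼ w j ->
         dense_below
           (fun q' => exists2 i : X, q' ≼ r i & forces_eq (s i) (t j) q') q)
  end.

Definition forces_mem (P : forcing_notion) (a b : name P) (p : P) : Prop :=
  match b with
  | Name Y t w =>
      dense_below (fun q => exists2 j : Y, q ≼ w j & forces_eq a (t j) q) p
  end.

Fixpoint forces (P : forcing_notion) (p : P) (phi : formula P) {struct phi} :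
    Prop :=
  match phi with
  | FMem a b => forces_mem a b p
  | FEq a b => forces_eq a b p
  | FNot phi => forall q : P, q ≼ p -> ~ forces q phi
  | FAnd phi psi => forces p phi /\ forces p psi
  | FAll phi => forall x : name P, forces p (phi x)
  end.

Notation "p ⊩ phi" := (forces p phi%F)
  (at level 99, phi at level 200, no associativity) : type_scope.

Definition FImp (P : forcing_notion) (phi psi : formula P) : formula P :=
  FNot (FAnd phi (FNot psi)).
Definition FOr (P : forcing_notion) (phi psi : formula P) : formula P :=
  FNot (FAnd (FNot phi) (FNot psi)).
Definition FIff (P : forcing_notion) (phi psi : formula P) : formula P :=
  FAnd (FImp phi psi) (FImp psi phi).
Definition FEx (P : forcing_notion) (phi : name P -> formula P) : formula P :=
  FNot (FAll (fun x => FNot (phi x))).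

Notation "x ∈ a" := (FMem x a) (at level 70, no associativity) : forcing_scope.
Notation "x ≡ y" := (FEq x y) (at level 70, no associativity) : forcing_scope.
Notation "¬ phi" := (FNot phi) (at level 75, right associativity)
  : forcing_scope.
Notation "phi ∧ psi" := (FAnd phi psi) (at level 80, right associativity)
  : forcing_scope.
Notation "phi ∨ psi" := (FOr phi psi) (at level 85, right associativity)
  : forcing_scope.
Notation "phi ⇒ psi" := (FImp phi psi) (at level 90, right associativity)
  : forcing_scope.
Notation "phi ⇔ psi" := (FIff phi psi) (at level 95, no associativity)
  : forcing_scope.
Notation "∀ x , phi" := (FAll (fun x => phi))
  (at level 10, x name, phi at level 200) : forcing_scope.
Notation "∃ x , phi" := (FEx (fun x => phi))
  (at level 10, x name, phi at level 200) : forcing_scope.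
Notation "∀ x ∈ a , phi" := (FAll (fun x => FImp (FMem x a) phi))
  (at level 10, x name, a at level 69, phi at level 200) : forcing_scope.
Notation "∃ x ∈ a , phi" := (FEx (fun x => FAnd (FMem x a) phi))
  (at level 10, x name, a at level 69, phi at level 200) : forcing_scope.

(** ** Names for sets of the ground model *)

(* The name of {s i | i : I}.  Each s i is paired with every condition (and not
   only with a largest one, which is not part of the structure), so that it is
   evaluated in the set whatever the generic filter is.  Iterating [collect]
   gives the canonical ("check") names of the ground model sets. *)
Definition collect (P : forcing_notion) (I : Type) (s : I -> name P) : name P :=
  Name (fun ip : I * P => s ip.1) (fun ip => ip.2).

Definition upair (P : forcing_notion) (a b : name P) : name P :=
  collect (fun t : bool => if t then a else b).

(* Kuratowski pairs. *)
Definition opair (P : forcing_notion) (a b : name P) : name P :=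
  upair (upair a a) (upair a b).

(* The von Neumann numeral n = {0, ..., n - 1}. *)
Fixpoint nat_name (P : forcing_notion) (n : nat) : name P :=
  match n with
  | 0%N => collect (fun v : void => match v with end)
  | m.+1 =>
      match nat_name P m with
      | Name X s r =>
          Name (fun j : X + P => if j is inl i then s i else nat_name P m)
               (fun j => match j with inl i => r i | inr p => p end)
      end
  end.

Definition omega (P : forcing_notion) : name P := collect (nat_name P).

(* n >= 0 is coded by the pair (n, 0), and - n < 0 by the pair (0, n). *)
Definition int_name (P : forcing_notion) (z : int) : name P :=
  match z with
  | Posz n => opair (nat_name P n) (nat_name P 0)
  | Negz n => opair (nat_name P 0) (nat_name P n.+1)
  end.

Definition set_name (P : forcing_notion) (A : set int) : name P :=
  collect (fun x : {x : int | A x} => int_name P (sval x)).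

Definition ZZ (P : forcing_notion) : name P := set_name P [set: int].

(* The graph {((x, y), x + y)} of the addition of ZZ. *)
Definition ZZadd (P : forcing_notion) : name P :=
  collect (fun xy : int * int =>
    opair (opair (int_name P xy.1) (int_name P xy.2))
          (int_name P (xy.1 + xy.2))).

(** ** Formulas *)

Definition Subset (P : forcing_notion) (a b : name P) : formula P :=
  ∀ x ∈ a, x ∈ b.

(* f is a function from the class D to the class R. *)
Definition IsFun (P : forcing_notion) (D R : name P -> formula P)
    (f : name P) : formula P :=
  (∀ z ∈ f, ∃ x, ∃ y, D x ∧ R y ∧ z ≡ opair x y) ∧
  (∀ x, D x ⇒ ∃ y, R y ∧ opair x y ∈ f) ∧
  (∀ x, ∀ y, ∀ y', opair x y ∈ f ⇒ opair x y' ∈ f ⇒ y ≡ y').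

(* There is an injection from the class D into some n in omega. *)
Definition IsFinite (P : forcing_notion) (D : name P -> formula P) : formula P :=
  ∃ n ∈ omega P, ∃ g,
    IsFun D (fun i => i ∈ n) g ∧
    (∀ x, ∀ y, ∀ i, opair x i ∈ g ⇒ opair y i ∈ g ⇒ x ≡ y).

Definition NonprincipalUltrafilter (P : forcing_notion) (u : name P) :
    formula P :=
  (∀ A ∈ u, Subset A (ZZ P)) ∧
  ZZ P ∈ u ∧
  ¬ (set_name P set0 ∈ u) ∧
  (∀ A ∈ u, ∀ B ∈ u, ∀ C, (∀ x, x ∈ C ⇔ (x ∈ A ∧ x ∈ B)) ⇒ C ∈ u) ∧
  (∀ A ∈ u, ∀ B, Subset A B ⇒ Subset B (ZZ P) ⇒ B ∈ u) ∧
  (∀ A, ∀ B, Subset A (ZZ P) ⇒ (∀ x, x ∈ B ⇔ (x ∈ ZZ P ∧ ¬ (x ∈ A))) ⇒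
     A ∈ u ∨ B ∈ u) ∧
  (∀ x ∈ ZZ P, ¬ (upair x x ∈ u)).

Definition PPoint (P : forcing_notion) (u : name P) : formula P :=
  NonprincipalUltrafilter u ∧
  (∀ f, IsFun (fun x => x ∈ ZZ P) (fun n => n ∈ omega P) f ⇒
     ∃ A ∈ u,
       (∃ n ∈ omega P, ∀ x ∈ A, opair x n ∈ f) ∨
       (∀ n ∈ omega P, IsFinite (fun x => x ∈ A ∧ opair x n ∈ f))).

(* c : [ZZ]^2 -> 2; the value of c at {x, y} is the i with ({x, y}, i) in c. *)
Definition Colouring (P : forcing_notion) (c : name P) : formula P :=
  IsFun (fun e => ∃ x ∈ ZZ P, ∃ y ∈ ZZ P, ¬ (x ≡ y) ∧ e ≡ upair x y)
        (fun i => i ∈ nat_name P 2) c.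

Definition Invariant (P : forcing_notion) (c : name P) : formula P :=
  ∀ x ∈ ZZ P, ∀ y ∈ ZZ P, ∀ z ∈ ZZ P, ¬ (x ≡ y) ⇒
    ∀ x', ∀ y',
      opair (opair x z) x' ∈ ZZadd P ⇒ opair (opair y z) y' ∈ ZZadd P ⇒
      ∀ i, opair (upair x y) i ∈ c ⇔ opair (upair x' y') i ∈ c.

Definition ZRamsey (P : forcing_notion) (u : name P) : formula P :=
  ∀ c, Colouring c ⇒ Invariant c ⇒
    ∃ A ∈ u, ∃ i ∈ nat_name P 2, ∀ x ∈ A, ∀ y ∈ A,
      ¬ (x ≡ y) ⇒ opair (upair x y) i ∈ c.

(** * The forcing notion P(ZZ)/I_{k-thin} *)

Definition k_thin (k : nat) (A : set int) : Prop :=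
  forall g : int, g != 0 -> [set g + a | a in A] `&` A #<= `I_k.

Definition thin_ideal (k : nat) : set (set int) :=
  [set X | exists F : set (set int),
     [/\ finite_set F, F `<=` k_thin k & X `<=` \bigcup_(A in F) A]].

Definition thin_positive (k : nat) : Type := {A : set int | ~ thin_ideal k A}.

(* The order of the quotient algebra, on representatives: [A] <= [B] iff A \ B
   is in the ideal. *)
Definition thin_le (k : nat) (A B : thin_positive k) : Prop :=
  thin_ideal k (sval A `\` sval B).

Lemma thin_le_refl (k : nat) (A : thin_positive k) : thin_le A A.
Proof.
by exists set0; split=> //; rewrite setDv.
Qed.

Lemma thin_le_trans (k : nat) (B A C : thin_positive k) :
  thin_le A B -> thin_le B C -> thin_le A C.
Proof.
move=> [F [Ffin Fthin FAB]] [G [Gfin Gthin GBC]].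
exists (F `|` G); split.
- by rewrite finite_setU.
- by move=> X [/Fthin|/Gthin].
move=> x [Ax nCx]; have [Bx|nBx] := pselect (sval B x).
  by have [X GX Xx] := GBC x (conj Bx nCx); exists X => //; right.
by have [X FX Xx] := FAB x (conj Ax nBx); exists X => //; left.
Qed.

Definition thin_forcing (k : nat) : forcing_notion :=
  ForcingNotion (@thin_le_refl k) (@thin_le_trans k).

(* The name of the generic ultrafilter {A | [A] in the generic filter}; sets in
   the ideal have class 0 and never belong to it. *)
Definition generic_ultrafilter (k : nat) : name (thin_forcing k) :=
  Name (fun A : thin_forcing k => set_name (thin_forcing k) (sval A))
       (fun A => A).

(* Main.v *)
Require Import Defs.
From mathcomp Require Import all_boot all_order all_algebra.
From mathcomp Require finmap.
From mathcomp Require Import boolp classical_sets functions cardinality filter.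
From mathcomp Require Import zify.

(** Being a union of n k-thin sets is determined by finite subsets (compactness
    of the space of n-colourings), so a set containing, for every n, a finite
    set which is not a union of n k-thin sets is positive.  Hence a decreasing
    sequence of positive sets has a positive pseudo-intersection, up to finite
    errors: the forcing adds no new functions on ZZ, and a ground model function
    with no positive fibre is finite-to-one on some stronger condition.

    Below any positive set there is a positive union Y of finite blocks F_n such
    that no difference between distinct blocks is a difference inside a block.
    Colour d according to whether it is a difference inside a block: a
    homogeneous subset of Y lies in one block, or meets each block at most once
    and is then sparse, hence 1-thin.  So no positive subset of Y is
    homogeneous. *)

Set Implicit Arguments.
Unset Strict Implicit.
Unset Printing Implicit Defensive.
Import GRing.Theory.
Local Open Scope classical_set_scope.
Local Open Scope card_scope.
Local Open Scope ring_scope.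

(** * The forcing relation *)

Section Forcing.
Variable P : forcing_notion.
Implicit Types (a b c d x : name P) (p q r : P) (phi psi : formula P).

Lemma dense_below_intro (D : P -> Prop) p :
  (forall q, q ≼ p -> D q) -> dense_below D p.
Proof. by move=> h q qp; exists q; [exact: stronger_refl | exact: h]. Qed.

Lemma dense_below_mono (D : P -> Prop) p q :
  q ≼ p -> dense_below D p -> dense_below D q.
Proof. by move=> qp h r rq; apply: h; apply: stronger_trans qp. Qed.

Lemma forces_mono phi p q : q ≼ p -> (p ⊩ phi) -> q ⊩ phi.
Proof.
elim: phi p q => [a b|a b|phi IH|phi IH1 psi IH2|phi IH] p q qp /=.
- by case: b => Y t w /=; apply: dense_below_mono.
- case: a b => X s r [Y t w] /= [h1 h2]; split=> i q' q'q; [apply: h1|apply: h2];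
  exact: stronger_trans qp.
- by move=> h r rq; apply: h; apply: stronger_trans qp.
- by case=> h1 h2; split; [apply: IH1 h1|apply: IH2 h2].
- by move=> h x; apply: IH (h x).
Qed.

(** Induction on [phi]. Atomic formulas are density statements already. For a negation, an extension
    of [p] forcing the negated formula would have a further extension forcing both it and its
    negation. *)
Lemma forces_dense phi p : dense_below (fun q => q ⊩ phi) p -> p ⊩ phi.
Proof.
elim: phi p => [a b|a b|phi IH|phi IH1 psi IH2|phi IH] p /= h.
- case: b h => Y t w /= h q qp; have [r rq hr] := h q qp.
  have [r' r'r hr'] := hr r (stronger_refl r); exists r' => //.
  exact: stronger_trans rq.
- case: a b h => X s r [Y t w] /= h; split=> i q qp qi q' q'q.
  + have [q1 q1q' [h1 _]] := h q' (stronger_trans q'q qp).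
    have q1i : q1 ≼ r i by apply: stronger_trans q1q' (stronger_trans q'q qi).
    have [q2 q2q1 [j hj e]] := h1 i q1 (stronger_refl _) q1i q1 (stronger_refl _).
    by exists q2; [apply: stronger_trans q1q'|exists j].
  + have [q1 q1q' [_ h1]] := h q' (stronger_trans q'q qp).
    have q1i : q1 ≼ w i by apply: stronger_trans q1q' (stronger_trans q'q qi).
    have [q2 q2q1 [j hj e]] := h1 i q1 (stronger_refl _) q1i q1 (stronger_refl _).
    by exists q2; [apply: stronger_trans q1q'|exists j].
- move=> q qp hq; have [r rq hr] := h q qp.
  by apply: (hr r (stronger_refl _)); apply: forces_mono hq.
- split; [apply: IH1|apply: IH2] => q qp; have [r rq [? ?]] := h q qp;
  by exists r.
- by move=> x; apply: IH => q qp; have [r rq hr] := h q qp; exists r.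
Qed.

Arguments forces : simpl never.

(** The usual way to spend a density hypothesis: pass to a condition where a witness is available
    and prove the same formula there. *)
Lemma forces_cut (D : P -> Prop) phi p : dense_below D p ->
  (forall q, q ≼ p -> D q -> q ⊩ phi) -> p ⊩ phi.
Proof.
move=> hD h; apply: forces_dense => q qp.
have [r rq Dr] := hD q qp; exists r => //; apply: h Dr.
exact: stronger_trans qp.
Qed.

(** Implication is encoded by negation and conjunction. If [q] forces [phi], no extension of [q]
    forces the negation of [psi], so conditions forcing [psi] are dense below [q], and
    [forces_dense] applies. *)
Lemma forces_imp phi psi p :
  (p ⊩ phi ⇒ psi) <-> (forall q, q ≼ p -> (q ⊩ phi) -> q ⊩ psi).
Proof.
split=> [h q qp hq|h q qp [hq nq]]; last by apply: (nq q (stronger_refl _)); apply: h.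
apply: forces_dense => r rq; apply: contrapT => nr.
apply: (h r (stronger_trans rq qp)); split; first exact: forces_mono hq.
by move=> r' r'r hr'; apply: nr; exists r'.
Qed.

Lemma forces_mp phi psi p : (p ⊩ phi ⇒ psi) -> (p ⊩ phi) -> p ⊩ psi.
Proof. by move/forces_imp => h; apply: h; apply: stronger_refl. Qed.

Lemma forces_ex (phi : name P -> formula P) p :
  (p ⊩ FEx phi) <-> dense_below (fun q => exists x, q ⊩ phi x) p.
Proof.
split=> [h q qp|h q qp hq].
  apply: contrapT => nq; apply: (h q qp) => x r rq hr; apply: nq.
  by exists r => //; exists x.
by have [r rq [x hr]] := h q qp; apply: (hq x r rq hr).
Qed.

Lemma forces_exI (phi : name P -> formula P) p x : (p ⊩ phi x) -> p ⊩ FEx phi.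
Proof.
move=> h; apply/forces_ex; apply: dense_below_intro => q qp; exists x.
exact: forces_mono h.
Qed.

Lemma forces_exin a (phi : name P -> formula P) p :
  (p ⊩ FEx (fun x => FAnd (FMem x a) (phi x))) <->
  dense_below (fun q => exists x, (q ⊩ x ∈ a) /\ (q ⊩ phi x)) p.
Proof. exact: forces_ex. Qed.

Lemma forces_exinI a (phi : name P -> formula P) p x :
  (p ⊩ x ∈ a) -> (p ⊩ phi x) -> p ⊩ FEx (fun x => FAnd (FMem x a) (phi x)).
Proof. by move=> xa h; apply: (@forces_exI _ p x); split. Qed.

Lemma forces_orl phi psi p : (p ⊩ phi) -> p ⊩ phi ∨ psi.
Proof. by move=> h q qp [nq _]; apply: (nq q (stronger_refl _)); apply: forces_mono h. Qed.

Lemma forces_orr phi psi p : (p ⊩ psi) -> p ⊩ phi ∨ psi.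
Proof. by move=> h q qp [_ nq]; apply: (nq q (stronger_refl _)); apply: forces_mono h. Qed.

Lemma forces_iff phi psi p :
  (forall q, q ≼ p -> (q ⊩ phi) -> q ⊩ psi) ->
  (forall q, q ≼ p -> (q ⊩ psi) -> q ⊩ phi) -> p ⊩ phi ⇔ psi.
Proof. by move=> h1 h2; split; apply/forces_imp. Qed.

Lemma forces_iff1 phi psi p : (p ⊩ phi ⇔ psi) -> (p ⊩ phi) -> p ⊩ psi.
Proof. by case=> h _; apply: forces_mp. Qed.

Lemma forces_iff2 phi psi p : (p ⊩ phi ⇔ psi) -> (p ⊩ psi) -> p ⊩ phi.
Proof. by case=> _ h; apply: forces_mp. Qed.

Lemma forces_not phi p : (p ⊩ phi) -> (p ⊩ ¬ phi) -> False.
Proof. by move=> h /(_ p (stronger_refl _)). Qed.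

Lemma forces_all (phi : name P -> formula P) p :
  (forall x, p ⊩ phi x) -> p ⊩ FAll phi.
Proof. by []. Qed.

Lemma forces_inst (phi : name P -> formula P) x p :
  (p ⊩ FAll phi) -> p ⊩ phi x.
Proof. exact. Qed.

Lemma forces_and phi psi p : (p ⊩ phi ∧ psi) <-> (p ⊩ phi) /\ (p ⊩ psi).
Proof. by []. Qed.

Lemma forces_allin a (phi : name P -> formula P) p :
  (p ⊩ FAll (fun x => FImp (FMem x a) (phi x))) <->
  (forall x q, q ≼ p -> (q ⊩ x ∈ a) -> q ⊩ phi x).
Proof.
split=> h x; have [i1 i2] := forces_imp (x ∈ a)%F (phi x) p; first exact: i1 (h x).
exact: i2 (h x).
Qed.

(** * Equality, extensionality and pairing of names *)

Lemma forces_eq_refl a p : p ⊩ a ≡ a.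
Proof.
elim: a p => X s IH r p; split=> i q qp qi; apply: dense_below_intro => q' q'q;
  by exists i; [exact: stronger_trans qi|exact: IH].
Qed.

Lemma forces_eq_sym a b p : (p ⊩ a ≡ b) -> p ⊩ b ≡ a.
Proof.
elim: a b p => X s IH r [Y t w] p [h1 h2]; split=> i q qp qi q' q'q.
  by have [q1 q1q' [j ? e]] := h2 i q qp qi q' q'q; exists q1 => //; exists j => //; apply: IH.
by have [q1 q1q' [j ? e]] := h1 i q qp qi q' q'q; exists q1 => //; exists j => //; apply: IH.
Qed.

Lemma forces_eq_trans b a c p : (p ⊩ a ≡ b) -> (p ⊩ b ≡ c) -> p ⊩ a ≡ c.
Proof.
elim: a b c p => X s IH r [Y t w] [Z u v] p [h1 h2] [k1 k2].
split=> i q qp qi q' q'q.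
  have [q1 q1q' [j q1j e]] := h1 i q qp qi q' q'q.
  have q1p : q1 ≼ p by apply: stronger_trans (stronger_trans q1q' q'q) qp.
  have [q2 q2q1 [l q2l e']] := k1 j q1 q1p q1j q1 (stronger_refl _).
  exists q2; first exact: stronger_trans q1q'.
  exists l => //; apply: IH e'; exact: (forces_mono (phi := FEq _ _) q2q1 e).
have [q1 q1q' [j q1j e]] := k2 i q qp qi q' q'q.
have q1p : q1 ≼ p by apply: stronger_trans (stronger_trans q1q' q'q) qp.
have [q2 q2q1 [l q2l e']] := h2 j q1 q1p q1j q1 (stronger_refl _).
exists q2; first exact: stronger_trans q1q'.
exists l => //; apply: IH e' _; exact: (forces_mono (phi := FEq _ _) q2q1 e).
Qed.

Lemma mem_eql a a' b p : (p ⊩ a ≡ a') -> (p ⊩ a ∈ b) -> p ⊩ a' ∈ b.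
Proof.
case: b => Y t w aa' h q qp; have [r rq [j rj e]] := h q qp.
exists r => //; exists j => //; apply: forces_eq_trans e; apply: forces_eq_sym.
by apply: forces_mono aa'; apply: stronger_trans qp.
Qed.

Lemma mem_eqr a b b' p : (p ⊩ b ≡ b') -> (p ⊩ a ∈ b) -> p ⊩ a ∈ b'.
Proof.
case: b b' => Y t w [Z u v] [h _] k q qp; have [r rq [j rj e]] := k q qp.
have rp : r ≼ p by apply: stronger_trans qp.
have [r' r'r [l r'l e']] := h j r rp rj r (stronger_refl _).
exists r'; first exact: stronger_trans rq.
exists l => //; apply: forces_eq_trans e'; exact: (forces_mono (phi := FEq _ _) r'r e).
Qed.

(** Below [r i] the name [s i] is forced to be a member of [Name s r], so a test against arbitrary
    names covers the members listed in [a] and in [b]. *)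
Lemma forces_eq_ext a b p :
  (forall x q, q ≼ p -> (q ⊩ x ∈ a) -> q ⊩ x ∈ b) ->
  (forall x q, q ≼ p -> (q ⊩ x ∈ b) -> q ⊩ x ∈ a) -> p ⊩ a ≡ b.
Proof.
have mem_in X (s : X -> name P) (r : X -> P) i q : q ≼ r i -> q ⊩ s i ∈ Name s r.
  move=> qi; apply: dense_below_intro => q' q'q; exists i; last exact: forces_eq_refl.
  exact: stronger_trans qi.
case: a b => X s r [Y t w] h1 h2; split=> i q qp qi.
  exact: (h1 _ q qp (mem_in _ _ _ _ _ qi)).
have k := h2 _ q qp (mem_in _ _ _ _ _ qi).
move=> q' q'q; have [q1 q1q' [j q1j e]] := k q' q'q.
by exists q1 => //; exists j => //; apply: forces_eq_sym.
Qed.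

Lemma mem_collect (I : Type) (s : I -> name P) x p :
  (p ⊩ x ∈ collect s) <-> dense_below (fun q => exists i, q ⊩ x ≡ s i) p.
Proof.
split=> h q qp; have [r rq] := h q qp.
  by case=> [[i r'] _ e]; exists r => //; exists i.
by case=> i e; exists r => //; exists (i, r) => //; apply: stronger_refl.
Qed.

Lemma mem_collectI (I : Type) (s : I -> name P) i p : p ⊩ s i ∈ collect s.
Proof.
apply/mem_collect; apply: dense_below_intro => q _; exists i; exact: forces_eq_refl.
Qed.

Lemma mem_upair x a b p :
  (p ⊩ x ∈ upair a b) <-> dense_below (fun q => (q ⊩ x ≡ a) \/ (q ⊩ x ≡ b)) p.
Proof.
split=> [/mem_collect|] h; last apply/mem_collect; move=> q qp;
  have [r rq hr] := h q qp; exists r => //.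
  by case: hr => -[] e; [left|right].
by case: hr => e; [exists true|exists false].
Qed.

Lemma mem_upairl a b p : p ⊩ a ∈ upair a b.
Proof. by apply/mem_upair; apply: dense_below_intro => q _; left; apply: forces_eq_refl. Qed.

Lemma mem_upairr a b p : p ⊩ b ∈ upair a b.
Proof. by apply/mem_upair; apply: dense_below_intro => q _; right; apply: forces_eq_refl. Qed.

Lemma upair_sub a b a' b' p : (p ⊩ a ≡ a') -> (p ⊩ b ≡ b') ->
  forall x q, q ≼ p -> (q ⊩ x ∈ upair a b) -> q ⊩ x ∈ upair a' b'.
Proof.
move=> ea eb x q qp /mem_upair h; apply/mem_upair => r rq.
have [r' r'r e] := h r rq; exists r' => //.
have r'p : r' ≼ p by apply: stronger_trans (stronger_trans r'r rq) qp.
by case: e => e; [left|right]; apply: forces_eq_trans e _;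
  [apply: forces_mono ea|apply: forces_mono eb].
Qed.

Lemma upair_eq a b a' b' p : (p ⊩ a ≡ a') -> (p ⊩ b ≡ b') ->
  p ⊩ upair a b ≡ upair a' b'.
Proof.
move=> ea eb; apply: forces_eq_ext => x q qp; first exact: (upair_sub ea eb qp).
by apply: (upair_sub _ _ qp); apply: forces_eq_sym.
Qed.

Lemma opair_eq a b a' b' p : (p ⊩ a ≡ a') -> (p ⊩ b ≡ b') ->
  p ⊩ opair a b ≡ opair a' b'.
Proof. by move=> ea eb; do 2!apply: upair_eq => //. Qed.

(** Which of the two matchings holds may depend on the generic filter, so it is only decided
    densely. *)
Lemma upair_inj a b c d p : (p ⊩ upair a b ≡ upair c d) ->
  dense_below (fun q => (q ⊩ a ≡ c) /\ (q ⊩ b ≡ d) \/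
                        (q ⊩ a ≡ d) /\ (q ⊩ b ≡ c)) p.
Proof.
move=> e.
have := mem_eqr e (@mem_upairl a b p); move/mem_upair => ha.
have := mem_eqr e (@mem_upairr a b p); move/mem_upair => hb.
have := mem_eqr (forces_eq_sym e) (@mem_upairl c d p); move/mem_upair => hc.
have := mem_eqr (forces_eq_sym e) (@mem_upairr c d p); move/mem_upair => hd.
(* Four successive extensions decide, for each of [a], [b], [c], [d], an element of the other pair
   equal to it. *)
move=> q qp; have [q1 q1q e1] := ha q qp.
have [q2 q2q1 e2] := hb q1 (stronger_trans q1q qp).
have [q3 q3q2 e3] := hc q2 (stronger_trans q2q1 (stronger_trans q1q qp)).
have [q4 q4q3 e4] :=
  hd q3 (stronger_trans q3q2 (stronger_trans q2q1 (stronger_trans q1q qp))).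
have m3 := forces_mono q4q3.
have m2 phi := forces_mono (phi := phi) (stronger_trans q4q3 q3q2).
have m1 phi := forces_mono (phi := phi) (stronger_trans q4q3 (stronger_trans q3q2 q2q1)).
exists q4.
  exact: stronger_trans (stronger_trans q4q3 (stronger_trans q3q2 q2q1)) q1q.
have {}e1 : (q4 ⊩ a ≡ c) \/ (q4 ⊩ a ≡ d) by case: e1; [left|right]; apply: m1.
have {}e2 : (q4 ⊩ b ≡ c) \/ (q4 ⊩ b ≡ d) by case: e2; [left|right]; apply: m2.
have {}e3 : (q4 ⊩ c ≡ a) \/ (q4 ⊩ c ≡ b) by case: e3; [left|right]; apply: m3.
case: e1 => e1; case: e2 => e2; try by [left|right].
- left; split=> //; case: e4 => /forces_eq_sym e4 //.
  by apply: forces_eq_trans e2 _; apply: forces_eq_trans (forces_eq_sym e1) e4.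
- right; split=> //; case: e3 => /forces_eq_sym e3 //.
  by apply: forces_eq_trans e2 _; apply: forces_eq_trans (forces_eq_sym e1) e3.
Qed.

(** Every matching of the Kuratowski pairs yields the same two equalities, so [forces_cut] removes
    the density left by [upair_inj]. *)
Lemma opair_inj a b c d p : (p ⊩ opair a b ≡ opair c d) ->
  (p ⊩ a ≡ c) /\ (p ⊩ b ≡ d).
Proof.
move=> /upair_inj h.
have h1 : p ⊩ a ≡ c.
  apply: forces_cut h _ => q qp.
  case=> [[/upair_inj e _]|[/upair_inj e _]];
    by apply: forces_cut e _ => r rq [[e _]|[_ e]].
split=> //; apply: forces_cut h _ => q qp.
case=> [[_ /upair_inj e]|[/upair_inj e /upair_inj e']].
  apply: forces_cut e _ => r rq [[_ e]//|[ea eb]].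
  apply: forces_eq_trans eb _; apply: forces_eq_trans ea; apply: forces_eq_sym.
  exact: forces_mono (stronger_trans rq qp) h1.
have hbc : q ⊩ b ≡ c by apply: forces_cut e' _ => r rq [[_ e0]|[_ e0]].
have had : q ⊩ a ≡ d by apply: forces_cut e _ => r rq [[_ e0]|[e0 _]].
apply: forces_eq_trans hbc (forces_eq_trans _ had); apply: forces_eq_sym.
exact: forces_mono qp h1.
Qed.

(** * Absoluteness of numerals, integers and ground model sets of integers *)

Lemma mem_nat_nameS n x p : (p ⊩ x ∈ nat_name P n.+1) <->
  dense_below (fun q => (q ⊩ x ∈ nat_name P n) \/ (q ⊩ x ≡ nat_name P n)) p.
Proof.
rewrite /=; set m := nat_name P n; case: m => X s r.
split=> h q qp; have [q1 q1q hq1] := h q qp.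
  case: hq1 => [[i|r']] /= hi e; exists q1 => //; last by right.
  left; apply: dense_below_intro => q2 q2q1; exists i.
    exact: stronger_trans hi.
  exact: (forces_mono (phi := FEq _ _) q2q1 e).
case: hq1 => [hx|e].
  have [q2 q2q1 [i q2i e]] := hx q1 (stronger_refl _).
  by exists q2; [apply: stronger_trans q1q|exists (inl i)].
by exists q1 => //; exists (inr q1) => //; apply: stronger_refl.
Qed.

Lemma mem_nat_name n x p : (p ⊩ x ∈ nat_name P n) <->
  dense_below (fun q => exists2 m, (m < n)%N & q ⊩ x ≡ nat_name P m) p.
Proof.
elim: n p => [|n IH] p.
  split=> [/mem_collect|] h; last apply/mem_collect.
    by move=> q qp; have [r rq []] := h q qp; case.
  by move=> q qp; have [r rq [m]] := h q qp.
split=> [/mem_nat_nameS h q qp|h].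
  have [r rq [/IH hr|e]] := h q qp; last by exists r => //; exists n.
  have [r' r'r [m mn e]] := hr r (stronger_refl _); exists r'.
    exact: stronger_trans rq.
  by exists m => //; apply: ltnW.
apply/mem_nat_nameS => q qp; have [r rq [m]] := h q qp.
rewrite ltnS leq_eqVlt => /orP[/eqP-> e|mn e]; exists r => //; [by right|left].
apply/IH; apply: dense_below_intro => r' r'r; exists m => //; exact: forces_mono e.
Qed.

Lemma mem_nat_name_lt m n p : (m < n)%N -> p ⊩ nat_name P m ∈ nat_name P n.
Proof.
move=> mn; apply/mem_nat_name; apply: dense_below_intro => q _.
by exists m => //; apply: forces_eq_refl.
Qed.

(** If the numeral of [n.+1] were a member of itself, it would equal some [m] at most [n]. Then [n]
    would be a member of [m], hence equal to some [l] below [n], and so a member of itself. *)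
Lemma nat_name_irrefl n p : ~ (p ⊩ nat_name P n ∈ nat_name P n).
Proof.
elim: n p => [|n IH] p /mem_nat_name /(_ p (stronger_refl _)) [q _ [m]] //.
rewrite ltnS => mn e.
have /mem_nat_name : q ⊩ nat_name P n ∈ nat_name P m.
  by apply: mem_eqr e _; apply: mem_nat_name_lt.
move=> /(_ q (stronger_refl _)) [r rq [l lm el]].
apply: (IH r); apply: mem_eql (forces_eq_sym el) _.
exact: mem_nat_name_lt (leq_trans lm mn).
Qed.

Lemma nat_name_inj m n p : (p ⊩ nat_name P m ≡ nat_name P n) -> m = n.
Proof.
move=> e; case: (ltngtP m n) => // h;
  [case: (@nat_name_irrefl m p)|case: (@nat_name_irrefl n p)].
  by apply: mem_eqr (forces_eq_sym e) _; apply: mem_nat_name_lt.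
by apply: mem_eqr e _; apply: mem_nat_name_lt.
Qed.

Lemma int_name_inj (x y : int) p : (p ⊩ int_name P x ≡ int_name P y) -> x = y.
Proof.
case: x y => [m|m] [n|n] /opair_inj [/nat_name_inj e1 /nat_name_inj e2] //.
- by rewrite e1.
- by case: e2 => ->.
Qed.

Lemma mem_omega x p : (p ⊩ x ∈ omega P) <->
  dense_below (fun q => exists m, q ⊩ x ≡ nat_name P m) p.
Proof. exact: mem_collect. Qed.

Lemma mem_set_name A x p : (p ⊩ x ∈ set_name P A) <->
  dense_below (fun q => exists2 z, A z & q ⊩ x ≡ int_name P z) p.
Proof.
split=> [/mem_collect|] h; last apply/mem_collect; move=> q qp;
  have [r rq hr] := h q qp; exists r => //.
  by case: hr => -[z Az] e; exists z.
by case: hr => z Az e; exists (exist _ z Az).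
Qed.

Lemma mem_set_nameE A (z : int) p : (p ⊩ int_name P z ∈ set_name P A) <-> A z.
Proof.
split=> [/mem_set_name /(_ p (stronger_refl _)) [q _ [z' ? /int_name_inj ->]] //|Az].
by apply/mem_set_name; apply: dense_below_intro => q _; exists z => //; apply: forces_eq_refl.
Qed.

Lemma set_name_sub A B p :
  (forall x q, q ≼ p -> (q ⊩ x ∈ set_name P A) -> q ⊩ x ∈ set_name P B) -> A `<=` B.
Proof.
move=> h z Az; apply/(@mem_set_nameE B z p); apply: h; first exact: stronger_refl.
exact/mem_set_nameE.
Qed.

Lemma set_name_inj A B p : (p ⊩ set_name P A ≡ set_name P B) -> A = B.
Proof.
move=> e; apply/seteqP; split; apply: (@set_name_sub _ _ p) => x q qp;
  apply: mem_eqr; [|apply: forces_eq_sym]; exact: forces_mono e.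
Qed.

Lemma mem_ZZ x p : (p ⊩ x ∈ ZZ P) <->
  dense_below (fun q => exists z, q ⊩ x ≡ int_name P z) p.
Proof.
split=> [/mem_set_name|] h; last apply/mem_set_name; move=> q qp;
  have [r rq hr] := h q qp; exists r => //.
  by case: hr => z _ e; exists z.
by case: hr => z e; exists z.
Qed.

Lemma int_name_ZZ (z : int) p : p ⊩ int_name P z ∈ ZZ P.
Proof. exact/mem_set_nameE. Qed.

Lemma set_name_ZZ A x p : (p ⊩ x ∈ set_name P A) -> p ⊩ x ∈ ZZ P.
Proof.
move=> /mem_set_name h; apply/mem_ZZ => q qp; have [r rq [z _ e]] := h q qp.
by exists r => //; exists z.
Qed.

(** * Functions and finiteness in the forcing language *)

Lemma IsFun_total (D R : name P -> formula P) f x p :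
  (p ⊩ IsFun D R f) -> (p ⊩ D x) -> p ⊩ ∃ y, R y ∧ opair x y ∈ f.
Proof.
move=> [_ [h _]]; have {}h : p ⊩ D x ⇒ ∃ y, R y ∧ opair x y ∈ f by exact: h x.
exact: forces_mp h.
Qed.

Lemma IsFun_functional (D R : name P -> formula P) f x y y' p :
  (p ⊩ IsFun D R f) -> (p ⊩ opair x y ∈ f) -> (p ⊩ opair x y' ∈ f) -> p ⊩ y ≡ y'.
Proof.
move=> [_ [_ h]] hy; apply: forces_mp.
have {}h : p ⊩ opair x y ∈ f ⇒ opair x y' ∈ f ⇒ y ≡ y' by exact: h x y y'.
exact: forces_mp h hy.
Qed.

Lemma IsFunI (D R : name P -> formula P) f p :
  (forall z q, q ≼ p -> (q ⊩ z ∈ f) -> q ⊩ ∃ x, ∃ y, D x ∧ R y ∧ z ≡ opair x y) ->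
  (forall x q, q ≼ p -> (q ⊩ D x) -> q ⊩ ∃ y, R y ∧ opair x y ∈ f) ->
  (forall x y y' q, q ≼ p -> (q ⊩ opair x y ∈ f) -> (q ⊩ opair x y' ∈ f) ->
     q ⊩ y ≡ y') ->
  p ⊩ IsFun D R f.
Proof.
move=> h1 h2 h3; split; [exact/forces_allin|split].
  by apply: forces_all => x; apply/forces_imp => q qp; apply: h2.
apply: forces_all => x; apply: forces_all => y; apply: forces_all => y'.
apply/forces_imp => q1 q1p hy; apply/forces_imp => q2 q21.
apply: h3 (forces_mono q21 hy); exact: stronger_trans q1p.
Qed.

Lemma IsFinite_seq (D : name P -> formula P) (l : seq int) p :
  (forall z : int, z \in l -> p ⊩ D (int_name P z)) ->
  (forall x q, q ≼ p -> (q ⊩ D x) ->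
     dense_below (fun r => exists2 z : int, z \in l & r ⊩ x ≡ int_name P z) q) ->
  p ⊩ IsFinite D.
Proof.
move=> Dl lD.
(* The injection into [size l] sends an integer to its first position in [l], so repetitions in [l]
   do no harm. *)
pose g := collect (fun z : {z : int | z \in l} =>
  opair (int_name P (sval z)) (nat_name P (index (sval z) l))).
have gI (z : int) q : z \in l -> q ⊩ opair (int_name P z) (nat_name P (index z l)) ∈ g.
  move=> zl; exact: (@mem_collectI _ (fun z : {z : int | z \in l} =>
    opair (int_name P (sval z)) (nat_name P (index (sval z) l))) (exist _ z zl)).
have gE x i q : (q ⊩ opair x i ∈ g) -> dense_below (fun r => exists z : int,
    [/\ z \in l, r ⊩ x ≡ int_name P z & r ⊩ i ≡ nat_name P (index z l)]) q.
  move=> /mem_collect h r rq; have [s sr [[z zl] /opair_inj[e1 e2]]] := h r rq.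
  by exists s => //; exists z.
apply: (@forces_exinI _ _ _ (nat_name P (size l))); first exact: mem_collectI.
apply: (@forces_exI _ _ g); apply/forces_and; split.
  apply: IsFunI => [z q qp /mem_collect h|x q qp Dx|x i i' q qp hi hi'].
  - apply: forces_cut h _ => r rq [[y yl] e].
    apply: (@forces_exI _ _ (int_name P y)).
    apply: (@forces_exI _ _ (nat_name P (index y l))).
    apply/forces_and; split.
      by apply: forces_mono (Dl y yl); apply: stronger_trans qp.
    by apply/forces_and; split=> //; apply: mem_nat_name_lt; rewrite index_mem.
  - apply: forces_cut (lD x q qp Dx) _ => r rq [z zl e].
    apply: (@forces_exI _ _ (nat_name P (index z l))).
    apply/forces_and; split; first by apply: mem_nat_name_lt; rewrite index_mem.
    apply: mem_eql (gI z r zl); apply: opair_eq (forces_eq_refl _ _).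
    exact: forces_eq_sym.
  - apply: forces_cut (gE _ _ _ hi) _ => r rq [z [zl e1 e2]].
    apply: forces_cut (gE _ _ _ (forces_mono rq hi')) _ => s sr [z' [_ e1' e2']].
    have E := int_name_inj (forces_eq_trans (forces_eq_sym (forces_mono sr e1)) e1').
    by rewrite -E in e2'; apply: forces_eq_trans (forces_mono sr e2) (forces_eq_sym e2').
apply: forces_all => x; apply: forces_all => y; apply: forces_all => i.
apply/forces_imp => q1 _ hx; apply/forces_imp => q q1q /gE hy.
apply: forces_cut hy _ => r rq [z [zl e1 e2]].
apply: forces_cut (gE _ _ _ (forces_mono (stronger_trans rq q1q) hx)) _.
move=> s sr [z' [z'l e1' e2']].
have E := nat_name_inj (forces_eq_trans (forces_eq_sym (forces_mono sr e2)) e2').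
have {}E : z = z' by rewrite -(nth_index 0 zl) E nth_index.
rewrite -E in e1'.
exact: forces_eq_trans e1' (forces_eq_sym (forces_mono sr e1)).
Qed.

(** * Names of invariant colourings from the ground model *)

Section InvariantColouring.
Variable chi : int -> bool.
Hypothesis chiN : forall d : int, chi (- d) = chi d.

(** A pair is coloured through its difference, and both orders of each pair are listed. The evenness
    of [chi] makes the two entries agree, so this is a function on unordered pairs. *)
Definition colouring_name : name P := collect (fun xy : {xy : int * int | xy.1 != xy.2} =>
  opair (upair (int_name P (sval xy).1) (int_name P (sval xy).2))
        (nat_name P (chi ((sval xy).1 - (sval xy).2)))).

Lemma mem_colouring_nameP x p : (p ⊩ x ∈ colouring_name) <->
  dense_below (fun q => exists2 yz : int * int, yz.1 != yz.2 &
    q ⊩ x ≡ opair (upair (int_name P yz.1) (int_name P yz.2))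
                  (nat_name P (chi (yz.1 - yz.2)))) p.
Proof.
split=> [/mem_collect|] h; last apply/mem_collect; move=> q qp;
  have [r rq hr] := h q qp; exists r => //.
  by case: hr => -[yz yzn] e; exists yz.
by case: hr => yz yzn e; exists (exist _ yz yzn).
Qed.

(** Matching two unordered pairs in swapped order changes the sign of the difference, which [chi]
    does not see. *)
Lemma mem_colouring_name (y z : int) i p : y != z ->
  (p ⊩ opair (upair (int_name P y) (int_name P z)) i ∈ colouring_name) <->
  (p ⊩ i ≡ nat_name P (chi (y - z))).
Proof.
move=> yz; split=> [/mem_colouring_nameP h|e]; last first.
  apply/mem_colouring_nameP; apply: dense_below_intro => q qp; exists (y, z) => //.
  by apply: opair_eq (forces_mono qp e); apply: forces_eq_refl.
apply: forces_cut h _ => q qp [[y' z'] /= y'z' /opair_inj[/upair_inj e1 e2]].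
apply: forces_cut e1 _ => r rq e1; have {}e2 := forces_mono rq e2.
by case: e1 => -[/int_name_inj-> /int_name_inj->]; rewrite // -chiN opprB.
Qed.

Lemma colouring_nameP p : p ⊩ Colouring colouring_name.
Proof.
have lt2 (b : bool) q : q ⊩ nat_name P b ∈ nat_name P 2.
  by apply: mem_nat_name_lt; case: b.
apply: IsFunI => [z q qp /mem_colouring_nameP h|x q qp hx|x i i' q qp hi hi'].
- apply: forces_cut h _ => r rq [[y y'] /= yy' e].
  apply: (@forces_exI _ _ (upair (int_name P y) (int_name P y'))).
  apply: (@forces_exI _ _ (nat_name P (chi (y - y')))).
  apply/forces_and; split; last by apply/forces_and; split.
  apply: (@forces_exinI _ _ _ (int_name P y)); first exact: int_name_ZZ.
  apply: (@forces_exinI _ _ _ (int_name P y')); first exact: int_name_ZZ.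
  apply/forces_and; split; last exact: forces_eq_refl.
  by move=> s _ /int_name_inj E; rewrite E eqxx in yy'.
- have /forces_exin {}hx := hx; apply: forces_cut hx _ => r1 _ [y [/mem_ZZ yZ /forces_exin h]].
  apply: forces_cut h _ => r2 r21 [z [/mem_ZZ zZ /forces_and[yz e]]].
  apply: forces_cut (dense_below_mono r21 yZ) _ => r3 r32 [y0 ey].
  apply: forces_cut (dense_below_mono r32 zZ) _ => r r3r [z0 ez].
  have {}ey := forces_mono r3r ey; have {}yz := forces_mono (stronger_trans r3r r32) yz.
  have {}e := forces_mono (stronger_trans r3r r32) e.
  have y0z0 : y0 != z0.
    apply/eqP => E; rewrite -E in ez.
    exact: forces_not (forces_eq_trans ey (forces_eq_sym ez)) yz.
  apply: (@forces_exI _ _ (nat_name P (chi (y0 - z0)))).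
  apply/forces_and; split=> //.
  have /(mem_eql (a := opair _ _)) : r ⊩ opair (upair (int_name P y0) (int_name P z0))
      (nat_name P (chi (y0 - z0))) ∈ colouring_name.
    by apply/mem_colouring_name => //; apply: forces_eq_refl.
  apply; apply: opair_eq (forces_eq_refl _ _).
  by apply: forces_eq_trans (upair_eq (forces_eq_sym ey) (forces_eq_sym ez)) (forces_eq_sym e).
have /mem_colouring_nameP h := hi; apply: forces_cut h _.
move=> r rq [[y z] /= yz /opair_inj[ex ei]].
have {}hi' := mem_eql (opair_eq ex (forces_eq_refl i' r)) (forces_mono rq hi').
apply: forces_eq_trans ei (forces_eq_sym _); exact: (iffLR (mem_colouring_name _ _ yz)).
Qed.

Lemma mem_ZZadd x z x' (i j : int) p :
  (p ⊩ opair (opair x z) x' ∈ ZZadd P) -> (p ⊩ x ≡ int_name P i) ->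
  (p ⊩ z ≡ int_name P j) -> p ⊩ x' ≡ int_name P (i + j).
Proof.
move=> /mem_collect h ex ez; apply: forces_cut h _.
move=> q qp [[i' j'] /opair_inj[/opair_inj[/= ex' ez'] e]].
have <- := int_name_inj (forces_eq_trans (forces_eq_sym ex') (forces_mono qp ex)).
by have <- := int_name_inj (forces_eq_trans (forces_eq_sym ez') (forces_mono qp ez)).
Qed.

(** Densely, [x], [y], [z] become integers [a0], [b0], [c0]. Then [x'] and [y'] are [a0 + c0] and
    [b0 + c0], with the same difference as [a0] and [b0]. *)
Lemma colouring_name_invariant p : p ⊩ Invariant colouring_name.
Proof.
apply/forces_allin => x q1 _ /mem_ZZ xZ; apply/forces_allin => y q2 q21 /mem_ZZ yZ.
apply/forces_allin => z q3 q32 /mem_ZZ zZ; apply/forces_imp => q4 q43 xy.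
apply: forces_all => x'; apply: forces_all => y'.
apply/forces_imp => q5 q54 hx; apply/forces_imp => q6 q65 hy.
apply: forces_all => i.
have q63 := stronger_trans q65 (stronger_trans q54 q43).
have q62 := stronger_trans q63 q32.
apply: forces_cut (dense_below_mono (stronger_trans q62 q21) xZ) _ => q7 q76 [a0 ea].
apply: forces_cut (dense_below_mono (stronger_trans q76 q62) yZ) _ => q8 q87 [b0 eb].
have q86 := stronger_trans q87 q76.
apply: forces_cut (dense_below_mono (stronger_trans q86 q63) zZ) _ => q q8q [c0 ec].
have {}ea := forces_mono (stronger_trans q8q q87) ea.
have {}eb := forces_mono q8q eb.
have q6q := stronger_trans q8q q86.
have ea' := mem_ZZadd (forces_mono (stronger_trans q6q q65) hx) ea ec.
have eb' := mem_ZZadd (forces_mono q6q hy) eb ec.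
have {}xy := forces_mono (stronger_trans q6q (stronger_trans q65 q54)) xy.
have ab : a0 != b0.
  apply/eqP => E; rewrite -E in eb.
  exact: forces_not (forces_eq_trans ea (forces_eq_sym eb)) xy.
have ab' : a0 + c0 != b0 + c0 by rewrite (inj_eq (addIr c0)).
have eab := upair_eq ea eb; have eab' := upair_eq ea' eb'.
have E : (a0 + c0) - (b0 + c0) = a0 - b0 by rewrite opprD addrACA subrr addr0.
apply: forces_iff => r rq h.
  have {}h := mem_eql (opair_eq (forces_mono rq eab) (forces_eq_refl i r)) h.
  apply: mem_eql (opair_eq (forces_eq_sym (forces_mono rq eab')) (forces_eq_refl i r)) _.
  by apply/mem_colouring_name => //; rewrite E; apply: (iffLR (mem_colouring_name i r ab)).
have {}h := mem_eql (opair_eq (forces_mono rq eab') (forces_eq_refl i r)) h.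
apply: mem_eql (opair_eq (forces_eq_sym (forces_mono rq eab)) (forces_eq_refl i r)) _.
by apply/mem_colouring_name => //; rewrite -E; apply: (iffLR (mem_colouring_name i r ab')).
Qed.

End InvariantColouring.

End Forcing.

(** * The ideal of the k-thin sets *)

(** Turns the cardinality bound in [k_thin] into a bound on duplicate-free lists, suited to finite
    combinatorics. An infinite [S] violates the bound because it has a subset of size [k.+1]. *)
Lemma card_le_seqP (T : choiceType) (S : set T) k : (S #<= `I_k) <->
  (forall s : seq T, uniq s -> (forall x, x \in s -> S x) -> (size s <= k)%N).
Proof.
split=> [/pcard_leP[f] s us sS|h].
  rewrite -(size_map f) -[X in (_ <= X)%N](size_iota 0).
  apply: uniq_leq_size.
    by rewrite map_inj_in_uniq // => x y /sS Sx /sS Sy; apply: inj; exact: mem_set.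
  move=> _ /mapP[x /sS Sx ->]; rewrite mem_iota /= add0n.
  exact: (@funS _ _ _ _ f x Sx).
have [Sfin|Sinf] := pselect (finite_set S).
  have [X SX] := iffLR finite_fsetP Sfin; rewrite SX.
  rewrite (card_le_eql (introT card_eq_fsetP erefl)) card_le_II.
  apply: h; first exact: finmap.fset_uniq.
  by move=> x xX; rewrite SX.
have [B BS kB] := infinite_set_fset k.+1 Sinf.
by have := h _ (finmap.fset_uniq B) BS; rewrite leqNgt kB.
Qed.

Section Thin.
Variable k : nat.
Implicit Types (X Y : set int) (s : seq int) (n : nat).

Lemma k_thinP X : k_thin k X <->
  (forall (g : int) s, g != 0 -> uniq s ->
     (forall x, x \in s -> X x /\ X (x - g)) -> (size s <= k)%N).
Proof.
split=> h g.
  move=> s g0 us sX; have /card_le_seqP := h g g0; apply=> // x /sX[Xx Xg].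
  by split=> //; exists (x - g) => //; rewrite addrC subrK.
move=> g0; apply/card_le_seqP => s us sX; apply: (h g s) => // x /sX[[a Xa <-] ?].
by rewrite addrAC subrr add0r.
Qed.

Lemma k_thin_sub X Y : X `<=` Y -> k_thin k Y -> k_thin k X.
Proof.
move=> XY /k_thinP h; apply/k_thinP => g s g0 us sX; apply: (h g s) => // x /sX[? ?].
by split; apply: XY.
Qed.

(** Covers are encoded as colourings with thin classes, because colourings, unlike families of sets,
    have limits along an ultrafilter. *)
Definition thin_cover n X := exists c : int -> nat,
  (forall x, X x -> (c x < n)%N) /\ forall i, k_thin k [set x | X x /\ c x = i].

Lemma thin_idealP X : thin_ideal k X <-> exists n, thin_cover n X.
Proof.
split=> [[F [/finite_seqP[s ->] Fthin XF]]|[n [c [cn cthin]]]].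
  (* The colour of a point is the index of the first set of the list containing it. *)
  pose c x := find (fun A : set int => `[< A x >]) s.
  have Xhas x : X x -> has (fun A : set int => `[< A x >]) s.
    by move=> /XF[A As Ax]; apply/hasP; exists A => //; exact/asboolP.
  exists (size s), c; split=> [x Xx|i]; first by rewrite -has_find; apply: Xhas.
  apply: (@k_thin_sub _ [set x | X x /\ c x = i /\ nth set0 s i x]).
    by move=> x [Xx <-]; do 2!split=> //; apply/asboolP; exact: nth_find (Xhas x Xx).
  (* For an index past the end of the list, [nth] returns [set0], so that colour class is empty. *)
  have [si|si] := ltnP i (size s).
    by apply: (@k_thin_sub _ (nth set0 s i)); [move=> x [_ []]|exact/Fthin/mem_nth].
  apply/k_thinP => g [//|x t] _ _ /(_ x); rewrite inE eqxx => /(_ isT)[[_ [_]]].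
  by rewrite nth_default.
exists [set [set x | X x /\ c x = i] | i in `I_n]; split.
- exact: finite_image.
- by move=> _ [i _ <-].
by move=> x Xx; exists [set y | X y /\ c y = c x] => //; exists (c x) => //; apply: cn.
Qed.

Lemma thin_ideal_sub X Y : X `<=` Y -> thin_ideal k Y -> thin_ideal k X.
Proof. by move=> XY [F [? ? YF]]; exists F; split=> //; apply: subset_trans YF. Qed.

Lemma thin_ideal0 : thin_ideal k set0.
Proof. by exists set0; split. Qed.

Lemma thin_idealU X Y :
  thin_ideal k X -> thin_ideal k Y -> thin_ideal k (X `|` Y).
Proof.
move=> [F [Ff Ft XF]] [G [Gf Gt YG]]; exists (F `|` G); split.
- by rewrite finite_setU.
- by move=> A [/Ft|/Gt].
by move=> x [/XF|/YG] [A ? ?]; exists A => //; [left|right].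
Qed.

Lemma thin_ideal_bigcup n (B : nat -> set int) :
  (forall i, (i < n)%N -> thin_ideal k (B i)) ->
  thin_ideal k (\bigcup_(i < n) B i).
Proof.
elim: n => [|n IH] h; first by rewrite II0 bigcup_set0; apply: thin_ideal0.
apply: thin_ideal_sub (thin_idealU (IH (fun i ilt => h i (ltnW ilt))) (h n (ltnSn n))).
move=> x [i /=]; rewrite ltnS leq_eqVlt => /orP[/eqP-> ?|? ?]; first by right.
by left; exists i.
Qed.

Lemma thin_ideal_finite X : finite_set X -> thin_ideal k X.
Proof.
move=> Xf; exists [set [set x] | x in X]; split; first exact: finite_image.
  move=> _ [x _ <-]; apply/k_thinP => g [//|y t] g0 _ /(_ y).
  rewrite inE eqxx => /(_ isT) /= [-> /eqP].
  by rewrite -subr_eq0 addrAC subrr add0r oppr_eq0 (negbTE g0).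
by move=> x Xx; exists [set x] => //; exists x.
Qed.

Lemma thin_cover_sub n X Y : X `<=` Y -> thin_cover n Y -> thin_cover n X.
Proof.
move=> XY [c [cn ct]]; exists c; split=> [x /XY/cn //|i].
by apply: k_thin_sub (ct i) => x [/XY].
Qed.

(** * Compactness of finite covers by thin sets *)

Lemma ultra_lt (G : set_system nat) (f : nat -> nat) n : UltraFilter G ->
  G [set N | (f N < n)%N] -> exists2 i, (i < n)%N & G [set N | f N = i].
Proof.
move=> GU; elim: n => [|n IH] h; first by case: (filter_ex h).
have [hn|hn] := in_ultra_setVsetC [set N | f N = n] GU; first by exists n.
have [|i ilt Gi] := IH; last by exists i => //; apply: ltnW.
apply: filterS (filterI h hn) => N /= [].
by rewrite ltnS leq_eqVlt => /orP[/eqP|].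
Qed.

Lemma filter_all_in (T : eqType) (V : Type) (G : set_system V)
  (P : T -> set V) (t : seq T) : Filter G -> (forall x, x \in t -> G (P x)) ->
  G [set N | forall x, x \in t -> P x N].
Proof.
move=> GF; elim: t => [|a t IH] h; first by apply: filterS filterT => N _ x.
have ha := h a (mem_head a t).
have ht : G [set N | forall x, x \in t -> P x N].
  by apply: IH => x xt; apply: h; rewrite inE xt orbT.
apply: filterS (filterI ha ht) => N [? hN] x; rewrite inE => /orP[/eqP->|/hN] //.
Qed.

(** Choose a good colouring of each set of a finite exhaustion of [X] and take the limit along a
    nonprincipal ultrafilter. A violation of thinness for the limit involves finitely many points,
    so it would already occur in one of the chosen colourings. *)
Lemma thin_cover_compact n X :
  (forall s : seq int, [set` s] `<=` X -> thin_cover n [set` s]) -> thin_cover n X.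
Proof.
(* [e N] lists the elements of [X] with code below [N]. *)
move=> h; pose e N := [seq x <- pmap unpickle (iota 0 N) | `[< X x >]] : seq int.
have eX N : [set` e N] `<=` X by move=> x /=; rewrite mem_filter => /andP[/asboolP].
have [c hc] := choice (fun N => h _ (eX N)).
have [G [GU Goo]] := ultraFilterLemma eventually_filter.
have Ge x : X x -> G [set N | x \in e N].
  move=> Xx; apply: Goo; exists (pickle x).+1 => // N /= xN.
  rewrite mem_filter mem_pmap; apply/andP; split; first exact/asboolP.
  by apply/mapP; exists (pickle x); [rewrite mem_iota|rewrite pickleK].
have Gc x : exists i, X x -> (i < n)%N /\ G [set N | c N x = i].
  have [Xx|nXx] := pselect (X x); last by exists 0%N.
  have [|i ? ?] := @ultra_lt G (c^~ x) n GU; last by exists i.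
  by apply: filterS (Ge x Xx) => N xN; case: (hc N) => h1 _; apply: h1.
have [d hd] := choice Gc.
exists d; split=> [x /hd[] //|i]; apply/k_thinP => g s g0 us sX.
(* A single [N] has to serve for all points of [s] and their translates by [- g]; finite
   intersections of sets in [G] provide it. *)
have Gall : G [set N | forall x, x \in s -> [/\ x \in e N, x - g \in e N,
    c N x = i & c N (x - g) = i]].
  apply: (@filter_all_in _ _ G (fun x N => [/\ x \in e N, x - g \in e N,
    c N x = i & c N (x - g) = i])) => x /sX[[Xx dx] [Xg dg]].
  have [_ Gx] := hd x Xx; have [_ Gg] := hd _ Xg.
  apply: filterS (filterI (filterI (Ge _ Xx) (Ge _ Xg)) (filterI Gx Gg)) => N /=.
  by rewrite dx dg => -[[? ?] [? ?]].
have [N hN] := filter_ex Gall.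
have [_ /(_ i)/k_thinP ct] := hc N.
by apply: (ct g s) => // x /hN[].
Qed.

Lemma positive_finite_witness n X : ~ thin_ideal k X ->
  exists2 s : seq int, [set` s] `<=` X & ~ thin_cover n [set` s].
Proof.
move=> Xpos; apply: contrapT => h; apply: Xpos; apply/thin_idealP; exists n.
apply: thin_cover_compact => s sX; apply: contrapT => ns; apply: h.
by exists s.
Qed.

Lemma positive_bigcup (F : nat -> seq int) X :
  (forall n, [set` F n] `<=` X) -> (forall n, ~ thin_cover n [set` F n]) ->
  ~ thin_ideal k X.
Proof. by move=> FX Fn /thin_idealP[n /(thin_cover_sub (FX n))]; apply: Fn. Qed.

(** * Pseudo-intersections and residue classes of positive sets *)

(** Take the union of finite witnesses [s n] inside [B n], where [s n] has no cover by [n] thin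
    sets. Only the witnesses [s m] with [m < n] can leave [B n]. *)
Lemma pseudo_intersection (B : nat -> set int) :
  (forall n, B n.+1 `<=` B n) -> (forall n, ~ thin_ideal k (B n)) ->
  exists Y, [/\ Y `<=` B 0%N, ~ thin_ideal k Y & forall n, finite_set (Y `\` B n)].
Proof.
move=> Bdec Bpos.
have Bmono m n : (m <= n)%N -> B n `<=` B m.
  move=> /subnKC<-; elim: (n - m)%N => [|d IH]; first by rewrite addn0.
  by rewrite addnS; apply: subset_trans (Bdec _) IH.
have /choice[s hs] n : exists s : seq int, [set` s] `<=` B n /\ ~ thin_cover n [set` s].
  by have [s ? ?] := positive_finite_witness n (Bpos n); exists s.
exists (\bigcup_n [set` s n]); split.
- by move=> x [n _ /(proj1 (hs n))]; apply: Bmono.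
- by apply: (@positive_bigcup s) => n; [move=> x xs; exists n|case: (hs n)].
move=> n; apply: (@sub_finite_set _ _ (\bigcup_(m < n) [set` s m])).
  move=> x [[m _ xs] nB]; exists m => //=; rewrite ltnNge; apply/negP => nm.
  by apply: nB; apply: Bmono nm _ _; case: (hs m) => h _; apply: h.
by apply: bigcup_finite.
Qed.

Lemma positive_residue X R : (0 < R)%N -> ~ thin_ideal k X ->
  exists i : int, ~ thin_ideal k (X `&` [set x | (R%:Z %| x - i)%Z]).
Proof.
move=> R0 Xpos; apply: contrapT => h; apply: Xpos.
apply: thin_ideal_sub (@thin_ideal_bigcup R
  (fun i => X `&` [set x | (R%:Z %| x - i%:Z)%Z]) _) => [x Xx|i _]; last first.
  by apply: contrapT => hi; apply: h; exists i%:Z.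
have Rn0 : R%:Z != 0 by lia.
have xR : `|(x %% R)%Z|%N%:Z = (x %% R)%Z by rewrite gez0_abs ?modz_ge0.
exists `|(x %% R)%Z|%N; first by rewrite /= -ltz_nat xR ltz_pmod.
by split=> //=; rewrite xR -eqz_mod_dvd modz_mod.
Qed.

Lemma positive_setD X Y : ~ thin_ideal k X -> thin_ideal k Y ->
  ~ thin_ideal k (X `\` Y).
Proof.
move=> Xpos Yi h; apply: Xpos; apply: thin_ideal_sub (thin_idealU h Yi) => x Xx.
by have [?|?] := pselect (Y x); [right|left].
Qed.

(** Prepares the block construction: it allows the removal of a residue class around each of
    finitely many earlier points without losing positivity. Either [X] has no point of positive
    accumulation among the integers, or a pseudo-intersection is taken at one such point. *)
Lemma positive_scattered X : ~ thin_ideal k X -> exists Y, [/\ Y `<=` X,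
  ~ thin_ideal k Y & forall y, Y y -> exists2 R, (0 < R)%N &
    thin_ideal k (Y `&` [set x | (R%:Z %| x - y)%Z])].
Proof.
move=> Xpos.
have [[y0 hy0]|h] := pselect (exists y0 : int, forall R, (0 < R)%N ->
    ~ thin_ideal k (X `&` [set x | (R%:Z %| x - y0)%Z])); last first.
  exists X; split=> // y Xy; apply: contrapT => hy; apply: h; exists y => R R0 hR.
  by apply: hy; exists R.
(* Concentrate X around y0 in the profinite topology; no other integer is then
   an accumulation point. *)
pose B n := (X `&` [set x | (n`!%:Z %| x - y0)%Z]) `\` [set y0].
have [n x [[Xx xn] xy]|n|Y [YB Ypos Yfin]] := @pseudo_intersection B.
- split=> //; split=> //; apply: dvdz_trans xn.
  by rewrite factS PoszM dvdz_mull.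
- apply: positive_setD; first by apply: hy0; apply: fact_gt0.
  exact/thin_ideal_finite/finite_set1.
exists Y; split=> // [x /YB[[]//]|y /YB[[Xy _] yy0]].
(* This modulus exceeds the nonzero distance of [y] to [y0] and so does not divide it. Points
   congruent to [y] are then not congruent to [y0], hence lie outside the corresponding [B n], and
   [Y] has only finitely many of those. *)
exists (absz (y - y0)).+1 => //; apply: thin_ideal_finite.
apply: sub_finite_set (Yfin (absz (y - y0)).+1) => x [Yx xy]; split=> // -[[_ xn] _].
apply: yy0 => /=; move: xy xn; set R := (absz _).+1 => /= xy xn.
have : (R%:Z %| y - y0)%Z.
  have -> : y - y0 = (x - y0) - (x - y) by lia.
  apply: rpredB => //; apply: dvdz_trans xn.
  by rewrite factS PoszM dvdz_mulr.
rewrite dvdzE /= => /(dvdn_leq _).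
by rewrite /R ltnn absz_gt0 subr_eq0; case: eqP => // _ /(_ isT).
Qed.

(** * Separated blocks and the colouring by differences *)

(** Recursion step, with [E] the points chosen so far. Removing the residue classes of [E] and a
    bounded interval leaves a positive set; one of its residue classes is positive, and [F] is a
    finite witness in that class. *)
Lemma separated_block X (E : seq int) n : ~ thin_ideal k X ->
  (forall y, X y -> exists2 R, (0 < R)%N &
     thin_ideal k (X `&` [set x | (R%:Z %| x - y)%Z])) ->
  (forall y, y \in E -> X y) ->
  exists F : seq int, [/\ [set` F] `<=` X, ~ thin_cover n [set` F],
    forall x y, x \in F -> y \in E -> 4 * `|y| < `|x| :> int &
    exists R : nat, [/\ forall x x', x \in F -> x' \in F -> (R%:Z %| x - x')%Z,
      forall x y, x \in F -> y \in E -> ~~ (R%:Z %| x - y)%Z &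
      forall y y', y \in E -> y' \in E -> y != y' -> ~~ (R%:Z %| y - y')%Z]].
Proof.
move=> Xpos Xsc EX.
(* [R0] is the product of the moduli that [Xsc] gives for the points of [E], so its classes refine
   theirs. *)
have [R0 R0pos hR0] : exists2 R, (0 < R)%N &
    thin_ideal k (X `&` [set x | exists2 y, y \in E & (R%:Z %| x - y)%Z]).
  elim: E EX => [|y E IH] EX.
    by exists 1%N => //; apply: thin_ideal_sub thin_ideal0 => x [_ []].
  have [|R R0 hR] := IH; first by move=> z zE; apply: EX; rewrite inE zE orbT.
  have [R' R'0 hR'] := Xsc y (EX y (mem_head y E)).
  exists (R * R')%N; first by rewrite muln_gt0 R0.
  apply: thin_ideal_sub (thin_idealU hR' hR) => x [Xx [z]].
  rewrite inE PoszM => /orP[/eqP->|zE] d.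
    by left; split=> //; apply: dvdz_trans d; apply: dvdz_mull.
  by right; split=> //; exists z => //; apply: dvdz_trans d; apply: dvdz_mulr.
have [N hN] : exists N : nat, forall y, y \in E -> `|y| <= N%:Z.
  elim: E {EX hR0} => [|y E [N hN]]; first by exists 0%N.
  exists (absz y + N)%N => z; rewrite inE => /orP[/eqP->|/hN]; lia.
pose Z := [set x : int | `|x| <= 4 * N%:Z].
have Zfin : thin_ideal k Z.
  apply: thin_ideal_finite.
  apply: (@sub_finite_set _ _ [set` [seq i%:Z - (4 * N)%N%:Z | i <- iota 0 (8 * N).+1]]) => //.
  move=> x xN; rewrite /Z /= in xN; apply/mapP; exists (absz (x + (4 * N)%N%:Z)%R).
    by rewrite mem_iota; lia.
  by lia.
have pos1 := positive_setD (positive_setD Xpos hR0) Zfin.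
(* R0 keeps the new block out of the residue classes of E; the factor 2N+1 makes
   the elements of E pairwise incongruent. *)
pose R := (R0 * (2 * N).+1)%N.
have Rpos : (0 < R)%N by rewrite muln_gt0 R0pos.
have [i pos2] := positive_residue Rpos pos1.
have [F FX Fn] := positive_finite_witness n pos2.
exists F; split=> //.
- by move=> x /FX[[[]]].
- by move=> x y /FX[[_]] /= nZ _ /hN yN; rewrite /Z /= in nZ; lia.
exists R; split.
- move=> x x' /FX[_ /= d] /FX[_ /= d'].
  have -> : x - x' = (x - i) - (x' - i) by lia.
  exact: rpredB.
- move=> x y /FX[[[Xx nx] _] _] yE; apply/negP => d; apply: nx; split=> //.
  by exists y => //; apply: dvdz_trans d; rewrite PoszM dvdz_mulr.
move=> y y' /hN yN /hN y'N yy'; apply/negP.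
rewrite dvdzE /= => /(dvdn_leq _); rewrite absz_gt0 subr_eq0 => /(_ yy').
by rewrite leqNgt => /negP; apply; rewrite /R; nia.
Qed.

(** Two points [x], [y] of the intersection would give [x + (y - g) = y + (x - g)] with all four
    terms in [A]. Distinct elements differ in size by a factor above 4, so the largest term cannot
    be balanced. Hence the intersection has at most one point. *)
Lemma sparse_k_thin (A : set int) : (1 <= k)%N ->
  (forall x y, A x -> A y -> x != y -> 4 * `|x| < `|y| \/ 4 * `|y| < `|x|) ->
  k_thin k A.
Proof.
move=> k1 h; apply/k_thinP => g [|x [|y s]] g0 // /andP[]; rewrite inE negb_or.
move=> /andP[xy _] _ sA.
have [Ax Ax'] := sA x (mem_head _ _).
have [|Ay Ay'] := sA y; first by rewrite !inE eqxx orbT.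
have := h x y Ax Ay xy.
have := h (x - g) (y - g) Ax' Ay' _.
have := h x (x - g) Ax Ax' _.
have := h y (y - g) Ay Ay' _.
have := h x (y - g) Ax Ay' _.
have := h y (x - g) Ay Ax' _.
lia.
Qed.

Lemma positive_no_homogeneous X : (1 <= k)%N -> ~ thin_ideal k X ->
  exists Y (chi : int -> bool), [/\ Y `<=` X, ~ thin_ideal k Y,
    forall d, chi (- d) = chi d &
    forall (A : set int) i, A `<=` Y ->
      (forall x y, A x -> A y -> x != y -> chi (x - y) = i) -> thin_ideal k A].
Proof.
move=> k1 /positive_scattered[X' [X'X X'pos X'sc]].
have /choice[step hstep] (En : seq int * nat) :
    exists F : seq int, (forall y, y \in En.1 -> X' y) ->
    [/\ [set` F] `<=` X', ~ thin_cover En.2 [set` F],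
    forall x y, x \in F -> y \in En.1 -> 4 * `|y| < `|x| :> int &
    exists R : nat, [/\ forall x x', x \in F -> x' \in F -> (R%:Z %| x - x')%Z,
      forall x y, x \in F -> y \in En.1 -> ~~ (R%:Z %| x - y)%Z &
      forall y y', y \in En.1 -> y' \in En.1 -> y != y' -> ~~ (R%:Z %| y - y')%Z]].
  (* If the earlier points do not all lie in [X'], the requirement is vacuous and the empty list
     serves as a default. *)
  have [EX|nEX] := pselect (forall y, y \in En.1 -> X' y); last by exists [::] => /nEX.
  by have [F hF] := separated_block En.2 X'pos X'sc EX; exists F.
(* [E n] concatenates the blocks before the [n]-th, and [D] below is the set of differences inside
   blocks. *)
pose E := fix E n := if n is m.+1 then step (E m, m) ++ E m else [::].
pose F n := step (E n, n).
have EX n : forall y, y \in E n -> X' y.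
  elim: n => [//|n IH] y; rewrite /= mem_cat => /orP[|/IH //].
  by have [FX _ _ _] := hstep (E n, n) IH => /FX.
have hF n := hstep (E n, n) (EX n); rewrite /= in hF.
have FE m n x : (m < n)%N -> x \in F m -> x \in E n.
  elim: n => [//|n IH]; rewrite ltnS leq_eqVlt /= mem_cat => /orP[/eqP->|mn] xF.
    by rewrite xF.
  by rewrite IH ?orbT.
pose D d := exists n x y, [/\ x \in F n, y \in F n & d = x - y].
have DN d : D d -> D (- d).
  by move=> [n [x [y [? ? ->]]]]; exists n, y, x; rewrite opprB.
(* Suppose [x - y] is also a difference inside block [l]. For [l < n] it is too large, since [x]
   dominates all earlier points. For [l = n] the modulus of block [n] divides differences inside
   that block but not [x - y]. For [l > n] the modulus of block [l] separates the earlier points [x]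
   and [y]. *)
have FnD m n x y : (m < n)%N -> x \in F n -> y \in F m -> ~ D (x - y).
  move=> mn xF yF [l [x' [y' [x'F y'F e]]]].
  have yE := FE _ _ _ mn yF.
  have [_ _ big [R [RF RE _]]] := hF n.
  case: (ltngtP l n) => [ln|nl|E1].
  - have := big x y xF yE; have := big x x' xF (FE _ _ _ ln x'F).
    have := big x y' xF (FE _ _ _ ln y'F); lia.
  - have [_ _ _ [R' [RF' _ RE']]] := hF l.
    have xE' := FE _ _ _ nl xF; have yE' := FE _ _ _ (ltn_trans mn nl) yF.
    have xy : x != y.
      by apply/eqP => xy; have := RE x y xF yE; rewrite xy subrr dvdz0.
    by have := RE' x y xE' yE' xy; rewrite e RF'.
  - by subst l; have := RE x y xF yE; rewrite e RF.
exists (\bigcup_n [set` F n]), (fun d => `[< D d >]); split.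
- by move=> x [n _ xF]; apply: X'X; have [FX _ _ _] := hF n; apply: FX.
- by apply: (@positive_bigcup F) => n; [move=> x xF; exists n|case: (hF n)].
- move=> d; apply/asbool_equiv_eq; split=> /DN //; by rewrite opprK.
(* Colour [true] confines [A] to the finite block of any one of its points. *)
move=> A [] AY hA.
  have [[a Aa]|nA] := pselect (exists a, A a); last first.
    by apply: thin_ideal_sub thin_ideal0 => x Ax; apply: nA; exists x.
  have [n _ an] := AY a Aa.
  apply: (@thin_ideal_sub _ [set` F n]); last by apply: thin_ideal_finite.
  move=> x Ax; have [m _ xm] := AY x Ax.
  have [->//|xa] := eqVneq x a.
  have /asboolP Dxa := hA x a Ax Aa xa; have Dax : D (a - x) by rewrite -opprB; apply: DN.
  case: (ltngtP m n) => [mn|nm|<- //];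
    [case: (FnD m n a x)|case: (FnD n m x a)] => //.
(* Colour [false] leaves at most one point of [A] in each block, and the growth of the blocks makes
   [A] sparse. *)
exists [set A]; split; [exact: finite_set1| |by move=> x Ax; exists A].
move=> _ ->; apply: sparse_k_thin => // x y Ax Ay xy.
have [m _ xm] := AY x Ax; have [n _ yn] := AY y Ay.
case: (ltngtP m n) => [mn|nm|E1].
- by left; have [_ _ big _] := hF n; apply: big => //; apply: FE xm.
- by right; have [_ _ big _] := hF m; apply: big => //; apply: FE yn.
by subst n; have /asboolP := hA x y Ax Ay xy; case; exists m, x, y.
Qed.
End Thin.

(** * The generic ultrafilter *)

Section ThinForcing.
Variable k : nat.
Let P := thin_forcing k.
Let U := generic_ultrafilter k.
Implicit Types (p q r : P) (a b x : name P).

Arguments forces : simpl never.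

(** * Distributivity: no new functions on the integers *)

Lemma thin_extend p (X : set int) : ~ thin_ideal k X -> X `<=` sval p ->
  exists2 q : P, q ≼ p & sval q = X.
Proof.
move=> Xpos Xp; exists (exist _ X Xpos) => //=; rewrite /thin_le /=.
by apply: thin_ideal_sub (thin_ideal0 k) => x [/Xp].
Qed.

Lemma thin_stronger_setI p q : q ≼ p -> ~ thin_ideal k (sval q `&` sval p).
Proof.
move=> qp h; apply: (svalP q); apply: thin_ideal_sub (thin_idealU h qp) => x qx.
by have [?|?] := pselect (sval p x); [left|right].
Qed.

(** Meet the dense sets one after the other and take a pseudo-intersection of the resulting
    sequence. Finite sets lie in the ideal, so it is stronger than every term. *)
Lemma thin_distributive (D : nat -> P -> Prop) p :
  (forall n q r, r ≼ q -> D n q -> D n r) -> (forall n, dense_below (D n) p) ->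
  dense_below (fun q => forall n, D n q) p.
Proof.
move=> Dopen Ddense p' p'p.
(* Intersecting with the previous condition gives true inclusion, not only inclusion modulo the
   ideal, as [pseudo_intersection] requires. *)
have /choice[step hstep] (nq : nat * P) : exists r,
    sval r `<=` sval nq.2 /\ (nq.2 ≼ p -> D nq.1 r).
  case: nq => n q /=; have [qp|nqp] := pselect (q ≼ p); last by exists q; split=> [x|/nqp].
  have [r rq Dr] := Ddense n q qp.
  have [r' r'r E] := thin_extend (thin_stronger_setI rq) (@subIsetl _ _ _).
  by exists r'; split=> [|_]; [rewrite E; apply: subIsetr|apply: Dopen Dr].
pose s := fix s n := if n is m.+1 then step (m, s m) else p'.
have sdec n : sval (s n.+1) `<=` sval (s n) by have [] := hstep (n, s n).
have sle n : s n ≼ p.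
  elim: n => [//|n]; apply: stronger_trans.
  by apply: thin_ideal_sub (thin_ideal0 k) => x [/sdec ? []].
have [Y [Yp' Ypos Yfin]] := pseudo_intersection sdec (fun n => svalP (s n)).
have [q qp' qE] := thin_extend Ypos Yp'; exists q => // n.
apply: (@Dopen n (s n.+1)); last by have [_ h] := hstep (n, s n); apply: h; apply: sle.
by apply: thin_ideal_finite; rewrite qE; apply: Yfin.
Qed.

Lemma mem_generic x p : (p ⊩ x ∈ U) <->
  dense_below (fun q => exists2 A : P, q ≼ A & q ⊩ x ≡ set_name P (sval A)) p.
Proof. by []. Qed.

Lemma mem_genericI (A : set int) x p : thin_ideal k (sval p `\` A) ->
  (p ⊩ x ≡ set_name P A) -> p ⊩ x ∈ U.
Proof.
move=> pA e; have Apos : ~ thin_ideal k A.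
  move=> h; apply: (svalP p); apply: thin_ideal_sub (thin_idealU pA h) => z pz.
  by have [?|?] := pselect (A z); [right|left].
pose B : P := exist _ A Apos.
apply/mem_generic; apply: dense_below_intro => q qp.
exists B; last exact: forces_mono e.
exact: (@stronger_trans P p q B qp pA).
Qed.

Lemma int_dense (D : int -> P -> Prop) p :
  (forall z q r, r ≼ q -> D z q -> D z r) -> (forall z, dense_below (D z) p) ->
  dense_below (fun q => forall z, D z q) p.
Proof.
move=> Dopen Ddense.
(* The integers are enumerated by their codes; a number coding no integer imposes no demand. *)
pose E n q := if @unpickle int n is Some z then D z q else True.
have h : dense_below (fun q => forall n, E n q) p.
  apply: thin_distributive => [n q r|n]; rewrite /E; case: unpickle => //.
    by move=> z rq; apply: Dopen rq.
  by apply: dense_below_intro.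
move=> q qp; have [r rq Er] := h q qp; exists r => // z.
by have := Er (pickle z); rewrite /E pickleK.
Qed.

Lemma decide_function f p :
  (p ⊩ IsFun (fun x => x ∈ ZZ P) (fun n => n ∈ omega P) f) ->
  dense_below (fun q => exists f0 : int -> nat,
    forall z, q ⊩ opair (int_name P z) (nat_name P (f0 z)) ∈ f) p.
Proof.
move=> hfun.
have h : dense_below (fun q => forall z, exists n,
    q ⊩ opair (int_name P z) (nat_name P n) ∈ f) p.
  apply: int_dense => [z q r rq [n hn]|z q qp].
    by exists n; apply: forces_mono hn.
  have /forces_ex hz := IsFun_total (forces_mono qp hfun) (@int_name_ZZ P z q).
  have [r rq [y /forces_and[/mem_omega hy hf]]] := hz q (stronger_refl q).
  have [r' r'r [n e]] := hy r (stronger_refl r); exists r'; first exact: stronger_trans rq.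
  exists n; apply: mem_eql (forces_mono r'r hf).
  by apply: opair_eq => //; apply: forces_eq_refl.
by move=> q qp; have [r rq /choice[f0 hf]] := h q qp; exists r => //; exists f0.
Qed.

(** Membership of each integer in [b] is densely decided, and by distributivity all these decisions
    can be made at once. *)
Lemma decide_subset b p : (p ⊩ Subset b (ZZ P)) ->
  dense_below (fun q => exists B, q ⊩ b ≡ set_name P B) p.
Proof.
move=> /forces_allin bZ.
have h : dense_below (fun q => forall z : int,
    (q ⊩ int_name P z ∈ b) \/ (q ⊩ ¬ (int_name P z ∈ b))) p.
  apply: int_dense => [z q r rq [] H|z q qp].
  - by left; apply: forces_mono H.
  - by right; apply: forces_mono H.
  have [nq|] := pselect (q ⊩ ¬ (int_name P z ∈ b)).
    by exists q; [exact: stronger_refl|right].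
  move=> /existsNP[r /not_implyP[rq /contrapT hr]].
  by exists r => //; left.
move=> q qp; have [r rq hr] := h q qp; exists r => //.
exists [set z | r ⊩ int_name P z ∈ b]; apply: forces_eq_ext => x s sr hx.
  have /mem_ZZ hZ := bZ x s (stronger_trans sr (stronger_trans rq qp)) hx.
  apply: forces_cut hZ _ => s' s's [z e].
  apply: mem_eql (forces_eq_sym e) _; apply/mem_set_nameE => /=.
  case: (hr z) => // nz; case: (forces_not (mem_eql e (forces_mono s's hx))).
  by apply: forces_mono nz; apply: stronger_trans sr.
have /mem_set_name hZ := hx; apply: forces_cut hZ _ => s' s's [z hz e].
apply: mem_eql (forces_eq_sym e) _; have {}hz : r ⊩ int_name P z ∈ b := hz.
by apply: forces_mono hz; apply: stronger_trans sr.
Qed.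

(** * The generic filter is a nonprincipal ultrafilter *)

Lemma generic_mem_ZZ p : p ⊩ ZZ P ∈ U.
Proof.
apply: (@mem_genericI setT); last exact: forces_eq_refl.
by apply: thin_ideal_sub (thin_ideal0 k) => x [_ []].
Qed.

(** Members of [U] are densely equal to ground model sets, and by [decide_subset] so are the other
    subsets of the integers involved. Each clause thereby becomes a statement about the ideal. *)
Lemma generic_ultrafilterP p : p ⊩ NonprincipalUltrafilter U.
Proof.
split.
  apply/forces_allin => A q qp /mem_generic hA.
  apply: forces_cut hA _ => r rq [B rB e]; apply/forces_allin => x s sr xA.
  by apply: set_name_ZZ (mem_eqr (forces_mono sr e) xA).
split; first exact: generic_mem_ZZ.
split.
  move=> q qp /mem_generic /(_ q (stronger_refl q)) [r rq [B rB]].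
  by move=> /set_name_inj E; apply: (svalP B); rewrite -E; apply: thin_ideal0.
split.
  apply/forces_allin => A q1 _ hA; apply/forces_allin => B q2 q21 hB.
  apply: forces_all => C; apply/forces_imp => q q2' hC.
  have {}hA := forces_mono (stronger_trans q2' q21) hA.
  have {}hB := forces_mono q2' hB; have /mem_generic hA' := hA; have /mem_generic hB' := hB.
  apply: forces_cut hA' _ => r rq [A0 rA eA].
  apply: forces_cut (dense_below_mono rq hB') _ => s sr [B0 sB eB].
  have sA := stronger_trans sr rA; have {}eA := forces_mono sr eA.
  apply: (@mem_genericI (sval A0 `&` sval B0)).
    apply: thin_ideal_sub (thin_idealU sA sB) => x [sx /= nx].
    have [Ax|nAx] := pselect (sval A0 x); last by left.
    by right; split=> // Bx; apply: nx.
  have hC' := forces_mono (stronger_trans sr rq) hC.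
  apply: forces_eq_ext => x t ts hx.
    have /forces_and[xA xB] := forces_iff1 (forces_mono ts (forces_inst x hC')) hx.
    have /mem_set_name hxA := mem_eqr (forces_mono ts eA) xA.
    apply: forces_cut hxA _ => t' t't [z Az e].
    apply: mem_eql (forces_eq_sym e) _; apply/mem_set_nameE; split=> //.
    apply/(@mem_set_nameE _ _ _ t'); apply: mem_eql e _.
    by apply: mem_eqr (forces_mono (stronger_trans t't ts) eB) (forces_mono t't xB).
  apply: forces_iff2 (forces_mono ts (forces_inst x hC')) _.
  have /mem_set_name hxC := hx; split.
    apply: forces_cut hxC _ => t' t't [z [Az Bz] e].
    apply: mem_eqr (forces_eq_sym (forces_mono (stronger_trans t't ts) eA)) _.
    by apply: mem_eql (forces_eq_sym e) _; apply/mem_set_nameE.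
  apply: forces_cut hxC _ => t' t't [z [Az Bz] e].
  apply: mem_eqr (forces_eq_sym (forces_mono (stronger_trans t't ts) eB)) _.
  by apply: mem_eql (forces_eq_sym e) _; apply/mem_set_nameE.
split.
  apply/forces_allin => A q1 _ hA.
  apply: forces_all => B; apply/forces_imp => q2 q21 AB.
  apply/forces_imp => q q2' /decide_subset hB.
  have /mem_generic hA' := forces_mono (stronger_trans q2' q21) hA.
  have /forces_allin ABq := forces_mono q2' AB.
  apply: forces_cut hA' _ => r rq [A0 rA eA].
  apply: forces_cut (dense_below_mono rq hB) _ => s sr [B0 eB].
  have sA := stronger_trans sr rA; have {}eA := forces_mono sr eA.
  have AB0 : sval A0 `<=` B0.
    apply: (@set_name_sub P _ _ s) => x t ts hx.
    apply: mem_eqr (forces_mono ts eB) _; apply: ABq.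
      exact: stronger_trans ts (stronger_trans sr rq).
    by apply: mem_eqr (forces_eq_sym (forces_mono ts eA)) hx.
  apply: (@mem_genericI B0) => //.
  by apply: thin_ideal_sub sA => x [sx nx]; split=> // /AB0.
split.
  apply: forces_all => A; apply: forces_all => B; apply/forces_imp => q1 _ /decide_subset hA.
  apply/forces_imp => q q21 hB; apply: forces_cut (dense_below_mono q21 hA) _.
  move=> r rq [A0 eA].
  have eB : r ⊩ B ≡ set_name P (~` A0).
    apply: forces_eq_ext => x t tr hx.
      have /forces_and[/mem_ZZ xZ xA] :=
        forces_iff1 (forces_mono (stronger_trans tr rq) (forces_inst x hB)) hx.
      apply: forces_cut xZ _ => t' t't [z e].
      apply: mem_eql (forces_eq_sym e) _; apply/mem_set_nameE => Az.
      apply: (xA t' t't).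
      apply: mem_eqr (forces_eq_sym (forces_mono (stronger_trans t't tr) eA)) _.
      by apply: mem_eql (forces_eq_sym e) _; apply/mem_set_nameE.
    apply: forces_iff2 (forces_mono (stronger_trans tr rq) (forces_inst x hB)) _.
    split; first exact: set_name_ZZ hx.
    move=> t' t't xA; have /mem_set_name := forces_mono t't hx.
    move=> /(_ t' (stronger_refl _)) [t'' t''t' [z nAz e]]; apply: nAz.
    apply/(@mem_set_nameE _ _ _ t''); apply: mem_eql e _.
    apply: mem_eqr (forces_mono t''t' xA).
    exact: forces_mono (stronger_trans t''t' (stronger_trans t't tr)) eA.
  (* A positive [s] has a positive part inside [A0] or outside it, and extending to that part
     decides the alternative. *)
  apply: forces_dense => s sr.
  have [hpos|hpos] := pselect (thin_ideal k (sval s `&` A0)).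
    have pos' : ~ thin_ideal k (sval s `\` A0).
      move=> h; apply: (svalP s); apply: thin_ideal_sub (thin_idealU h hpos) => x sx.
      by have [?|?] := pselect (A0 x); [right|left].
    have [t ts tE] := thin_extend pos' (@subIsetl _ _ _); exists t => //.
    apply: forces_orr; apply: (@mem_genericI (~` A0)).
      by apply: thin_ideal_sub (thin_ideal0 k) => x /=; rewrite tE => -[[_ h] []].
    by apply: forces_mono eB; apply: stronger_trans sr.
  have [t ts tE] := thin_extend hpos (@subIsetl _ _ _); exists t => //.
  apply: forces_orl; apply: (@mem_genericI A0).
    by apply: thin_ideal_sub (thin_ideal0 k) => x /=; rewrite tE => -[[_ h] []].
  by apply: forces_mono eA; apply: stronger_trans sr.
apply/forces_allin => x q _ /mem_ZZ hx r rq hr.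
have {}hr : r ⊩ upair x x ∈ U := hr.
have [s sr [z e]] := hx r rq.
have /mem_generic /(_ s (stronger_refl s)) [t ts [A tA eA]] := forces_mono sr hr.
(* The condition [A] would be a singleton, but finite sets lie in the ideal. *)
have eA' : t ⊩ upair x x ≡ set_name P [set z].
  have et := forces_mono ts e; apply: forces_eq_ext => y t' t't.
    move=> /mem_upair hy; apply/mem_set_name => t1 t1t'; have [t2 t21 h2] := hy t1 t1t'.
    exists t2 => //; exists z => //.
    have et2 := forces_mono (stronger_trans t21 (stronger_trans t1t' t't)) et.
    by case: h2 => h2; apply: forces_eq_trans h2 et2.
  move=> /mem_set_name hy; apply: forces_cut hy _ => t1 t1t' [_ /= -> ez].
  have et1 := forces_mono (stronger_trans t1t' t't) et.
  apply: mem_eql (mem_upairl x x (p := t1)).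
  exact: forces_eq_trans et1 (forces_eq_sym ez).
have := set_name_inj (forces_eq_trans (forces_eq_sym eA) eA') => E.
by apply: (svalP A); rewrite E; apply: thin_ideal_finite.
Qed.

(** * The P-point property *)

(** Extend into a positive fibre if there is one. Otherwise the sets where [f] is at least [n] are
    positive, and a pseudo-intersection of them meets each fibre in a finite set. *)
Lemma thin_constant_or_finite_to_one (f : int -> nat) p : exists2 q : P, q ≼ p &
  (exists n, forall z, sval q z -> f z = n) \/
  (forall n, finite_set [set z | sval q z /\ f z = n]).
Proof.
have [[n npos]|h] := pselect (exists n, ~ thin_ideal k (sval p `&` [set z | f z = n])).
  have [q qp qE] := thin_extend npos (@subIsetl _ _ _); exists q => //; left.
  by exists n => z; rewrite qE => -[].
pose B n := sval p `&` [set z | (n <= f z)%N].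
have Bdec n : B n.+1 `<=` B n by move=> z [pz /= nz]; split=> //=; apply: ltnW.
have Bpos n : ~ thin_ideal k (B n).
  move=> Bi; apply: (svalP p); apply: thin_ideal_sub (thin_idealU Bi
    (@thin_ideal_bigcup k n (fun i => sval p `&` [set z | f z = i]) _)) => [z pz|i _].
    have [nz|zn] := leqP n (f z); first by left.
    by right; exists (f z).
  by apply: contrapT => hi; apply: h; exists i.
have [Y [YB Ypos Yfin]] := pseudo_intersection Bdec Bpos.
have [q qp qE] := thin_extend Ypos (subset_trans YB (@subIsetl _ _ _)).
exists q => //; right=> n; apply: sub_finite_set (Yfin n.+1) => z; rewrite qE => -[Yz zn].
by split=> // -[_ /=]; rewrite zn ltnn.
Qed.

Lemma generic_PPoint p : p ⊩ PPoint U.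
Proof.
apply/forces_and; split; first exact: generic_ultrafilterP.
apply: forces_all => f; apply/forces_imp => q0 _ hf0.
apply: forces_cut (decide_function hf0) _ => q1 q10 [f0 hf1].
apply: forces_dense => q2 q21.
have [q q2q hq] := thin_constant_or_finite_to_one f0 q2; exists q => //.
have qq1 := stronger_trans q2q q21.
have hf := forces_mono (stronger_trans qq1 q10) hf0.
have {}hf1 z := forces_mono qq1 (hf1 z).
apply: (@forces_exinI P _ _ _ (set_name P (sval q))).
  by apply: (@mem_genericI (sval q)); [exact: (stronger_refl q)|exact: forces_eq_refl].
have hfE (z : int) x n r : r ≼ q -> (r ⊩ x ≡ int_name P z) -> (r ⊩ n ≡ nat_name P (f0 z)) ->
    r ⊩ opair x n ∈ f.
  move=> rq ex en; apply: mem_eql (forces_mono rq (hf1 z)).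
  by apply: opair_eq; apply: forces_eq_sym.
case: hq => [[n qn]|qfin]; [apply: forces_orl|apply: forces_orr].
  apply: (@forces_exinI P _ _ _ (nat_name P n)); first exact: mem_collectI.
  apply/forces_allin => x r rq /mem_set_name hx; apply: forces_cut hx _ => s sr [z qz e].
  by apply: hfE (stronger_trans sr rq) e _; rewrite (qn z qz); apply: forces_eq_refl.
apply/forces_allin => n' r rq /mem_omega hn'; apply: forces_cut hn' _ => s sr [n en].
have sq := stronger_trans sr rq.
(* A ground model enumeration of the fibre witnesses its finiteness in the extension. *)
have /finite_seqP[l hl] := qfin n.
apply: (@IsFinite_seq P _ l) => [z zl|x t ts /forces_and[/mem_set_name hx hxf]].
  have [qz zn] : [set z | sval q z /\ f0 z = n] z by rewrite hl.
  apply/forces_and; split; first by apply/mem_set_nameE.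
  by apply: (@hfE z) => //; [exact: forces_eq_refl|rewrite zn].
move=> t1 t1t; have [t2 t21 [z qz e]] := hx t1 t1t; exists t2 => //; exists z => //.
have t2t := stronger_trans t21 t1t; have t2s := stronger_trans t2t ts.
suff zn : f0 z = n by have : [set z | sval q z /\ f0 z = n] z by []; rewrite hl.
have e1 := hfE z x (nat_name P (f0 z)) t2 (stronger_trans t2s sq) e (forces_eq_refl _ _).
have e2 := IsFun_functional (forces_mono (stronger_trans t2s sq) hf) e1 (forces_mono t2t hxf).
exact: nat_name_inj (forces_eq_trans e2 (forces_mono t2s en)).
Qed.

(** * Failure of the invariant Ramsey property *)

(** Below a condition forcing the Ramsey property, pass to the set [Y] of [positive_no_homogeneous].
    A homogeneous member of [U] is densely a ground model set [A0], whose trace on [Y] lies in the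
    ideal although some condition is below both. *)
Lemma generic_not_ZRamsey p : (1 <= k)%N -> p ⊩ ¬ ZRamsey U.
Proof.
move=> k1 q _ hq; have {}hq : q ⊩ ZRamsey U := hq.
have [Y [chi [Yq Ypos chiN Yhom]]] := positive_no_homogeneous k1 (svalP q).
have [r rq rE] := thin_extend Ypos Yq.
have {}hq := forces_inst (colouring_name P chi) (forces_mono rq hq).
have {}hq := forces_mp (forces_mp hq (@colouring_nameP P chi chiN r))
  (@colouring_name_invariant P chi chiN r).
have /forces_exin/(_ r (stronger_refl r)) := hq.
move=> [r1 r1r [A [/mem_generic hA /forces_exin hi]]].
have [r2 r21 [A0 r2A0 eA]] := hA r1 (stronger_refl r1).
have [r3 r32 [i [/mem_nat_name i2 /forces_allin hom]]] := hi r2 r21.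
have [r4 r43 [j _ ei]] := i2 r3 (stronger_refl r3).
have r4A0 : r4 ≼ A0 := stronger_trans (stronger_trans r43 r32) r2A0.
have r4r : r4 ≼ r.
  exact: stronger_trans (stronger_trans r43 r32) (stronger_trans r21 r1r).
have chiE (x y : int) : sval A0 x -> sval A0 y -> x != y -> chi (x - y) = j :> nat.
  move=> Ax Ay xy.
  have memA z : sval A0 z -> r3 ⊩ int_name P z ∈ A.
    move=> Az; apply: mem_eqr (forces_eq_sym (forces_mono r32 eA)) _.
    exact/mem_set_nameE.
  have /forces_allin hom' := hom _ r3 (stronger_refl r3) (memA x Ax).
  have h : r3 ⊩ ¬ (int_name P x ≡ int_name P y).
    by move=> s _ /int_name_inj E; rewrite E eqxx in xy.
  have := forces_mp (hom' _ r3 (stronger_refl r3) (memA y Ay)) h.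
  move=> /(mem_colouring_name chiN _ _ xy) e.
  exact: nat_name_inj (forces_eq_trans (forces_eq_sym (forces_mono r43 e)) ei).
have hY : thin_ideal k (sval A0 `&` Y).
  (* The colour [j] is a natural number here, the value of a boolean under coercion; the test
     [j == 1] recovers the boolean. *)
  apply: (Yhom _ (j == 1)%N) => [x []//|x y [Ax _] [Ay _] xy].
  by rewrite -(chiE x y Ax Ay xy); case: (chi _).
(* Up to the ideal, [r4] is contained in [A0] and in [Y], hence in their intersection, so it would
   not be positive. *)
apply: (svalP r4); apply: thin_ideal_sub (thin_idealU hY (thin_idealU r4A0 r4r)) => x r4x.
have [Ax|] := pselect (sval A0 x); last by right; left.
by have [Yx|] := pselect (Y x); [left|right; right; rewrite rE].
Qed.

End ThinForcing.

Theorem corollary3p8 (k : nat) (hk : (1 <= k)%N) (p : thin_forcing k) :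
  p ⊩ PPoint (generic_ultrafilter k) ∧ ¬ ZRamsey (generic_ultrafilter k).
Proof.
by split; [exact: generic_PPoint|exact: generic_not_ZRamsey].
Qed.
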